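(* Let $m_0\in C_c^1(-L,L)$ and suppose that the maximal existence time $T_{max}$ of the classical solution $(u,m)$ to the mCH equation with initial datum $m_0$ is finite. Let $X$ be the associated flow on $[-L,L]\times[0,T_{max}]$, and let $$F_{T_{max}}=\{X(\xi,T_{max}):\xi\in[-L,L],\ X_\xi(\xi,T_{max})=0\},$$ $$\widehat F_{T_{max}}=\{x\in F_{T_{max}}: X^{-1}(x,T_{max})=[\xi_1,\xi_2]\ \text{for some}\ \xi_1<\xi_2\}.$$ Assume $F_{T_{max}}=\{x_i\}_{i=1}^{N_1}$ and $\widehat F_{T_{max}}=\{x_i\}_{i=1}^{N}$ with $N\le N_1$. Let $X^{-1}(x_i,T_{max})=[\xi_{i1},\xi_{i2}]$ and $p_i=\int_{\xi_{i1}}^{\xi_{i2}}m_0(\xi)\,d\xi$ for $1\le i\le N$. Then, as Radon measures, $$m(x,T_{max})=m_1(x)+\sum_{i=1}^Np_i\,\delta(x-x_i),$$ where $m_1\in L^1(\mathbb{R})$ is the function given by $$m_1(x)=\begin{cases}m(x,T_{max}),& x\in O_{T_{max}},\\ 0,& x\in\mathbb{R}\setminus O_{T_{max}},\end{cases}\qquad O_{T_{max}}=\{X(\xi,T_{max}):\xi\in(-L,L),\ X_\xi(\xi,T_{max})>0\}.$$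
   Context: $L>0$ is a fixed constant. $G(x)=\frac12e^{-|x|}$, with $G'(x)=-\frac12\mathrm{sgn}(x)e^{-|x|}$ for $x\neq0$. The mCH equation with initial datum $m_0$ is $$m_t+[(u^2-u_x^2)m]_x=0,\quad m=u-u_{xx},\quad x\in\mathbb{R},\ t>0,\qquad m(x,0)=m_0(x),$$ with $u=G\ast m$. The flow $X$ is the solution of the Lagrange dynamics $\dot X(\xi,t)=U(X(\xi,t),t)$, $X(\xi,0)=\xi\in[-L,L]$, where $$U(x,t)=\Big(\int_{-L}^LG(x-X(\theta,t))m_0(\theta)d\theta\Big)^2-\Big(\int_{-L}^LG'(x-X(\theta,t))m_0(\theta)d\theta\Big)^2 .$$ The classical solution is $u(x,t)=\int_{-L}^LG(x-X(\theta,t))m_0(\theta)d\theta$, $m=u-u_{xx}$, for $t\in[0,T_{max})$. $T_{max}$ is characterized by $\|m(\cdot,t)\|_{L^\infty}<+\infty$ for $0\le t<T_{max}$ and $\limsup_{t\to T_{max}}\|m(\cdot,t)\|_{L^\infty}=+\infty$ when $T_{max}<\infty$. The flow extends to $t=T_{max}$ with $X,X_\xi,X_{\xi\xi},\partial_tX$ continuous on $[-L,L]\times[0,T_{max}]$; it satisfies $X_\xi>0$ for $t<T_{max}$ and $X_\xi(\cdot,T_{max})\ge0$. $X^{-1}(x,T_{max})$ denotes $\{\xi\in[-L,L]:X(\xi,T_{max})=x\}$. $m(\cdot,T_{max})$ is the Radon measure on $\mathbb{R}$ which is the weak-$*$ limit of $m(\cdot,t)$ as $t\to T_{max}$; equivalently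 $m(\cdot,T_{max})=u(\cdot,T_{max})-u_{xx}(\cdot,T_{max})$ in the distributional sense with $u(x,T_{max})=\int_{-L}^LG(x-X(\theta,T_{max}))m_0(\theta)d\theta$. For $x$ in the open set $O_{T_{max}}$, $m(x,T_{max})$ denotes the value of $u(\cdot,T_{max})-u_{xx}(\cdot,T_{max})$, which is a $C^1$ function there. *)

(* Defs.v *)
From HB Require Import structures.
From mathcomp Require Import all_boot all_order all_algebra.
From mathcomp Require Import all_classical all_reals all_analysis.

Set Implicit Arguments.
Unset Strict Implicit.
Unset Printing Implicit Defensive.

Import Order.TTheory GRing.Theory Num.Theory.
Import numFieldNormedType.Exports.

Local Open Scope classical_set_scope.
Local Open Scope ring_scope.

Section TestFunctions.
Context {R : realType}.

Definition supp (f : R -> R) : set R := closure [set x | f x != 0].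

Definition Cc (f : R -> R) : Prop := continuous f /\ compact (supp f).

(* C^1_c(]a, b[), its elements being extended by 0 to the whole line. *)
Definition C1c (a b : R) (f : R -> R) : Prop :=
  [/\ forall x, derivable f x 1,
      continuous (derive1 f),
      compact (supp f)
    & supp f `<=` `]a, b[].

End TestFunctions.

Section ModifiedCamassaHolm.
Context {R : realType}.
Notation mu := (@lebesgue_measure R).

Implicit Types (L T x t xi : R) (X u m : R -> R -> R).

Definition G x : R := expR (- `|x|) / 2.

(* G' off the origin; Num.sg 0 = 0 sets it to 0 at the origin. *)
Definition dG x : R := - (Num.sg x * expR (- `|x|) / 2).

Definition lagrange_u L (m0 : R -> R) X x t : R :=
  \int[mu]_(th in `[- L, L]) (G (x - X th t) * m0 th).

Definition lagrange_U L (m0 : R -> R) X x t : R :=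
  lagrange_u L m0 X x t ^+ 2 -
  (\int[mu]_(th in `[- L, L]) (dG (x - X th t) * m0 th)) ^+ 2.

Definition dx u x t : R := derive1 (fun y => u y t) x.

Definition dt u x t : R := derive1 (fun s => u x s) t.

Definition momentum u x t : R := u x t - dx (dx u) x t.

(* The first argument of X is the label xi, the second one is the time t.
   Xxi, Xxixi and Xt are X_xi, X_xixi and the time derivative of X. Two-sided
   derivatives are only prescribed at interior points; on the boundary of the
   rectangle the derivatives are the continuous extensions, as usual for C^k
   functions on a closed set. At t = T the velocity field is not prescribed,
   since G' is not defined at 0 and X(., T) may have flat pieces. *)
Record is_flow L (m0 : R -> R) T (X Xxi Xxixi Xt : R -> R -> R) : Prop := IsFlow {
  flow_cont : {within `[- L, L] `*` `[0, T],
    continuous (fun z : R * R => X z.1 z.2)} ;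
  flow_xi_cont : {within `[- L, L] `*` `[0, T],
    continuous (fun z : R * R => Xxi z.1 z.2)} ;
  flow_xixi_cont : {within `[- L, L] `*` `[0, T],
    continuous (fun z : R * R => Xxixi z.1 z.2)} ;
  flow_t_cont : {within `[- L, L] `*` `[0, T],
    continuous (fun z : R * R => Xt z.1 z.2)} ;
  flow_xiE : forall xi t, - L < xi < L -> 0 <= t <= T ->
    is_derive xi 1 (fun z => X z t) (Xxi xi t) ;
  flow_xixiE : forall xi t, - L < xi < L -> 0 <= t <= T ->
    is_derive xi 1 (fun z => Xxi z t) (Xxixi xi t) ;
  flow_tE : forall xi t, - L <= xi <= L -> 0 < t < T ->
    is_derive t 1 (fun s => X xi s) (Xt xi t) ;
  flow_ode : forall xi t, - L <= xi <= L -> 0 <= t < T ->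
    Xt xi t = lagrange_U L m0 X (X xi t) t ;
  flow_init : forall xi, - L <= xi <= L -> X xi 0 = xi ;
  flow_xi_gt0 : forall xi t, - L <= xi <= L -> 0 <= t < T -> 0 < Xxi xi t
}.

Record classical_solution (m0 : R -> R) T u m : Prop := ClassicalSolution {
  sol_ux : forall x t, 0 <= t < T -> derivable (fun y => u y t) x 1 ;
  sol_uxx : forall x t, 0 <= t < T -> derivable (fun y => dx u y t) x 1 ;
  sol_uxx_cont : forall t, 0 <= t < T -> continuous (fun x => dx (dx u) x t) ;
  sol_momentum : forall x t, 0 <= t < T -> m x t = u x t - dx (dx u) x t ;
  sol_conv : forall x t, 0 <= t < T ->
    u x t = \int[mu]_(y in setT) (G (x - y) * m y t) ;
  sol_m_cont : {within setT `*` `[0, T[,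
    continuous (fun z : R * R => m z.1 z.2)} ;
  sol_mx : forall x t, 0 <= t < T -> derivable (fun y => m y t) x 1 ;
  sol_mt : forall x t, 0 < t < T -> derivable (fun s => m x s) t 1 ;
  sol_eq : forall x t, 0 < t < T ->
    dt m x t + dx (fun y s => (u y s ^+ 2 - dx u y s ^+ 2) * m y s) x t = 0 ;
  sol_init : forall x, m x 0 = m0 x
}.

Definition Linfty_norm (f : R -> R) : \bar R := 'N[mu]_+oo [EFin \o f].

Record maximal_existence_time (m0 : R -> R) T u m : Prop := MaximalExistenceTime {
  max_gt0 : 0 < T ;
  max_sol : classical_solution m0 T u m ;
  max_bounded : forall t, 0 <= t < T -> (Linfty_norm (m^~ t) < +oo)%E ;
  max_blowup : limf_esup (fun t => Linfty_norm (m^~ t)) (at_left T) = +oo%E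
}.

Definition charge_integral (nu : {charge set (measurableTypeR R) -> \bar R})
    (phi : R -> R) : R :=
  let PN := cid (Hahn_decomposition nu) in
  let nuPN := projT2 (cid (projT2 PN)) in
  (\int[jordan_pos nuPN]_x phi x) - (\int[jordan_neg nuPN]_x phi x).

(* nu is the weak-* limit, as t tends to T from the left, of the measures with
   Lebesgue densities m(., t). *)
Definition weak_star_limit m T
    (nu : {charge set (measurableTypeR R) -> \bar R}) : Prop :=
  forall phi : R -> R, Cc phi ->
    \int[mu]_(x in setT) (phi x * m x t) @[t --> T^'-] -->
    charge_integral nu phi.

(* X^{-1}(x, t) *)
Definition flow_fiber L X x t : set R := [set xi | - L <= xi <= L /\ X xi t = x].

Definition F_set L T X (Xxi : R -> R -> R) : set R :=
  [set X xi T | xi in [set xi | - L <= xi <= L /\ Xxi xi T = 0]].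

Definition Fhat_set L T X (Xxi : R -> R -> R) : set R :=
  [set x | F_set L T X Xxi x /\
    exists a b : R, a < b /\ flow_fiber L X x T = `[a, b]%classic].

Definition O_set L T X (Xxi : R -> R -> R) : set R :=
  [set X xi T | xi in [set xi | - L < xi < L /\ 0 < Xxi xi T]].

End ModifiedCamassaHolm.

(* Main.v *)
Require Import Defs.
From HB Require Import structures.
From mathcomp Require Import all_boot all_order all_algebra.
From mathcomp Require Import all_classical all_reals all_analysis.
From mathcomp Require Import measurable_realfun.
From mathcomp Require Import ring lra.
Set Implicit Arguments.
Unset Strict Implicit.
Unset Printing Implicit Defensive.
Import Order.TTheory GRing.Theory Num.Theory.
Import numFieldNormedType.Exports.
Local Open Scope classical_set_scope.
Local Open Scope ring_scope.

(** Let [Y = X(., t)] and [g = X_xi(., t)] for some [t <= T].  The potential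
    [u(., t)] is the convolution of [G] with the image under [Y] of the measure
    [m0 dxi], and [(1 - d^2/dx^2) G] is the Dirac mass at the origin, so that
    [m(., t)] ought to be this image measure.  For [t < T] the map [Y] is a
    diffeomorphism onto its image and this is a statement about functions;
    letting [t] tend to [T], the weak limit of [m(., t)] is the image of
    [m0 dxi] under [X(., T)], by continuity of the flow.  The theorem is thus
    the Lebesgue decomposition of that image measure: the labels where
    [X_xi(., T) > 0] give the density [m1], the flat pieces
    [[xi_i1, xi_i2]] are collapsed to the points [x_i] and give the Dirac
    masses, and only finitely many labels are left over.

    Two facts make this precise, for every nondecreasing [Y] of class [C^1],
    hence for [t < T] and [t = T] alike.

    - If [g xi > 0] then [u - u_xx] equals [m0 xi / g xi] at [Y xi]
      ([momentum_regular]).  One splits the integral defining [u] at the label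
      of [x]: near [Y xi], [u = (e^-x p + e^x q) / 2] where
      [p] and [q] are primitives of [e^Y m0] and of [- e^-Y m0] read at the
      label of [x], and the contributions of [p'] and [q'] cancel in [u_x] and
      add up to [- m0 / g] in [u_xx] ([momentum_of_split]).
    - Substitution along [Y] holds for all measurable functions, flat pieces
      included: the image under [Y] of [g dxi] is the Lebesgue measure of
      the segment [Y a, Y b], as is seen on half-lines with the fundamental
      theorem of calculus ([integral_nondecreasing_substitution]).

    Together they give [integral_regular_momentum]: integrating [phi] against
    the restriction of [u - u_xx] to the image of [{g > 0}] amounts to
    integrating [phi (Y xi) m0 xi] over [{g > 0}].  For [t < T] this is
    [integral_momentum], which yields the weak limit ([weak_star_xflow]); for
    [t = T] it turns into [m1 dx] the part of the image measure carried by
    [{g > 0}], which [image_m0_decomposition] separates from the flat pieces.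
    Finally a finite signed measure is determined by its integrals of functions
    in [C_c] ([charge_integral_unique]), so any weak limit is this image
    measure. *)

(** * Measures with a density and image measures *)

Section Density.
Context d (T : measurableType d) {R : realType}.
Variables (mu : {sigma_finite_measure set T -> \bar R}) (h : T -> R).
Hypothesis h_ge0 : forall x, 0 <= h x.
Hypothesis inth : mu.-integrable setT (EFin \o h).

Let induced_charge_ge0 E : (0 <= induced_charge inth E)%E.
Proof. by apply: integral_ge0 => x _; rewrite lee_fin. Qed.

(** The measure [h mu]. Building it from the charge induced by [h] makes the
    Radon-Nikodym theorem available for it. *)
Definition density : set T -> \bar R := measure_of_charge _ induced_charge_ge0.

HB.instance Definition _ := Measure.on density.

Let density_fin : fin_num_fun density.
Proof. by move=> A mA; apply: fin_num_measure. Qed.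

HB.instance Definition _ := @Measure_isFinite.Build _ _ _ density density_fin.

Let densityE A : density A = (\int[mu]_(x in A) (h x)%:E)%E.
Proof. by []. Qed.

Let mh : measurable_fun setT h.
Proof. by apply/measurable_EFinP; exact: measurable_int inth. Qed.

Let density_dominated : density `<< mu.
Proof.
apply/null_content_dominatesP => A mA A0; rewrite densityE null_set_integral//.
by apply/measurable_funTS/measurable_EFinP.
Qed.

Let ge0_integral_density (f : T -> \bar R) :
  (forall x, 0 <= f x)%E -> measurable_fun setT f ->
  (\int[density]_x f x = \int[mu]_x (f x * (h x)%:E))%E.
Proof.
move=> f0 mf.
rewrite -(Radon_Nikodym_SigmaFinite.change_of_variables density_dominated)//.
have intRN := Radon_Nikodym_SigmaFinite.f_integrable density_dominated.
have mRN := measurable_int _ intRN.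
apply: ae_eq_integral => //.
- exact: emeasurable_funM.
- by apply: emeasurable_funM => //; exact/measurable_EFinP.
apply: ae_eqe_mul2l.
apply: integral_ae_eq => //; first exact/measurable_EFinP.
move=> E _ mE.
by rewrite -(Radon_Nikodym_SigmaFinite.f_integral density_dominated).
Qed.

(** The Radon-Nikodym derivative of [density] is [h] almost everywhere, because
    both have the same integrals.  Signed functions reduce to nonnegative ones because
    multiplication by [h >= 0] commutes with positive and negative parts. *)
Lemma integral_density (f : T -> R) : measurable_fun setT f ->
  (\int[density]_x (f x)%:E = \int[mu]_x (f x * h x)%:E)%E.
Proof.
move=> mf; rewrite integralE [RHS]integralE.
have pm : ((EFin \o f)^\+ \* (EFin \o h) = (fun x => (f x * h x)%:E)^\+)%E.
  apply/funext => x; rewrite /= !funeposE /= -!EFin_max -EFinM.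
  by rewrite maxr_pMl// mul0r.
have nm : ((EFin \o f)^\- \* (EFin \o h) = (fun x => (f x * h x)%:E)^\-)%E.
  apply/funext => x; rewrite /= !funenegE /= -?EFinN -!EFin_max -EFinM.
  by rewrite maxr_pMl// mul0r mulNr.
rewrite -pm -nm !ge0_integral_density//.
- exact/measurable_funeneg/measurable_EFinP.
- exact/measurable_funepos/measurable_EFinP.
Qed.

End Density.

Section ImageMeasure.
Context d1 d2 (T1 : measurableType d1) (T2 : measurableType d2) {R : realType}.
Variables (m : {finite_measure set T1 -> \bar R}) (f : T1 -> T2).
Hypothesis mf : measurable_fun setT f.

(** The measurability proof is an argument so that the measure structure can be
    inferred from the term. *)
Definition image_measure of measurable_fun setT f : set T2 -> \bar R :=
  pushforward m f.

Let image_measure0 : image_measure mf set0 = 0%E.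
Proof. exact: measure0. Qed.

Let image_measure_ge0 A : (0 <= image_measure mf A)%E.
Proof. exact: measure_ge0. Qed.

Let image_measure_sigma_additive : semi_sigma_additive (image_measure mf).
Proof. exact: measure_semi_sigma_additive. Qed.

HB.instance Definition _ := isMeasure.Build _ _ _ (image_measure mf)
  image_measure0 image_measure_ge0 image_measure_sigma_additive.

Let image_measure_fin : fin_num_fun (image_measure mf).
Proof.
move=> A mA; apply: fin_num_measure.
by rewrite -[X in measurable X]setTI; exact: mf.
Qed.

HB.instance Definition _ :=
  @Measure_isFinite.Build _ _ _ (image_measure mf) image_measure_fin.

Lemma integral_image_measure (g : T2 -> \bar R) : measurable_fun setT g ->
  (\int[image_measure mf]_y g y = \int[m]_x g (f x))%E.
Proof.
move=> mg; rewrite integralE [RHS]integralE; congr (_ - _)%E.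
- rewrite [LHS]ge0_integral_pushforward//; last exact: measurable_funepos.
  by rewrite preimage_setT; apply: eq_integral => x _ /=; rewrite !funeposE.
- rewrite [LHS]ge0_integral_pushforward//; last exact: measurable_funeneg.
  by rewrite preimage_setT; apply: eq_integral => x _ /=; rewrite !funenegE.
Qed.

End ImageMeasure.

(** * Substitution along a nondecreasing function *)

Section NondecreasingSubstitution.
Context {R : realType}.
Notation mu := (@lebesgue_measure R).
Variables (a b : R) (Y g : R -> R).
Hypothesis ab : a < b.
Hypothesis Yc : continuous Y.
Hypothesis Ynd : {homo Y : x y / x <= y}.
Hypothesis Yd : forall xi, a < xi < b -> is_derive xi 1 Y (g xi).
Hypothesis gc : continuous g.
Hypothesis g_ge0 : forall xi, 0 <= g xi.

Let integral_g beta : a <= beta <= b ->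
  (\int[mu]_(xi in `]a, beta[) (g xi)%:E = (Y beta - Y a)%:E)%E.
Proof.
move=> /andP[]; rewrite le_eqVlt => /predU1P[<- _|abeta betab].
  by rewrite set_itvoo0 integral_set0 subrr.
rewrite -(@integral_itv_bndoo _ _ _ _ true false); last first.
  apply: measurable_funTS; apply/measurable_EFinP.
  exact: continuous_measurable_fun gc.
have Yd' xi : xi \in `]a, beta[ -> is_derive xi 1 Y (g xi).
  rewrite in_itv/= => /andP[axi xib]; apply: Yd.
  by rewrite axi (lt_le_trans xib).
rewrite (@continuous_FTC2 _ g Y)//.
- exact: continuous_subspaceT.
- split => //.
  + by move=> xi /Yd' [].
  + exact/cvg_at_right_filter/Yc.
  + exact/cvg_at_left_filter/Yc.
- by move=> xi /Yd' [_ <-]; rewrite derive1E.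
Qed.

(** The point [beta] is the infimum of the superlevel set of [c]: with strict
    inequalities the preimage of a ray is exactly a ray, even when [Y] is
    constant to the right of [beta]. *)
Let first_hit c : Y a < c <= Y b ->
  exists beta, [/\ a <= beta <= b, Y beta = c &
    forall xi, (Y xi < c) = (xi < beta)].
Proof.
move=> /andP[Yac cYb].
pose S := [set xi | a <= xi <= b /\ c <= Y xi].
have Sb : S b by split=> //; rewrite lexx ltW.
have lbS : has_lbound S by exists a => xi [/andP[]].
have infS : has_inf S by split=> //; exists b.
set beta := inf S.
have abeta : a <= beta by apply: lb_le_inf; [exists b | move=> xi [/andP[]]].
have betab : beta <= b by exact: (ge_inf lbS).
have below xi : xi < beta -> Y xi < c.
  move=> xib; have [axi|xia] := leP a xi; last exact: (le_lt_trans (Ynd (ltW xia)) Yac).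
  rewrite ltNge; apply/negP => cY.
  have : S xi by split=> //; rewrite axi (le_trans (ltW xib)).
  by move/(ge_inf lbS); rewrite leNgt xib.
have Yge : c <= Y beta.
  rewrite leNgt; apply/negP => Yc'.
  have [e /= e0 eb] : \forall xi \near beta, Y xi < c.
    exact: (cvgr_lt (Y beta) (@Yc beta)).
  have [s Ss sbe] := inf_adherent e0 infS; have [_ cs] := Ss.
  have : Y s < c.
    apply: eb => /=; rewrite distrC ger0_norm ?subr_ge0; last exact: (ge_inf lbS).
    by rewrite ltrBlDl.
  by rewrite ltNge cs.
exists beta; split; first by rewrite abeta.
- apply/eqP; rewrite eq_le Yge andbT.
  have [z zab Yz] : exists2 z, z \in `[a, b] & Y z = c.
    apply: IVT; [exact: ltW|exact: continuous_subspaceT|].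
    have Yab : Y a <= Y b by apply: Ynd; exact: ltW.
    by rewrite (min_idPl Yab) (max_idPr Yab) (ltW Yac).
  rewrite -Yz; apply: Ynd; apply: (ge_inf lbS).
  by move: zab; rewrite in_itv/= => zab; split; rewrite ?Yz.
- move=> xi; apply/idP/idP; last exact: below.
  by apply: contraTT; rewrite -!leNgt => /Ynd; exact: le_trans.
Qed.

(* The two measures to be compared: [h dxi], to be pushed forward by [Y], and
   the Lebesgue measure of the segment [Y a, Y b]. *)
Let h xi := g xi * \1_`]a, b[ xi.
Let k y : R := \1_`[Y a, Y b] y.

Let h_ge0 xi : 0 <= h xi. Proof. by rewrite mulr_ge0 ?indic_ge0. Qed.
Let k_ge0 y : 0 <= k y. Proof. by []. Qed.

Let integral_h A : measurable A ->
  (\int[mu]_(xi in A) (h xi)%:E = \int[mu]_(xi in A `&` `]a, b[) (g xi)%:E)%E.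
Proof.
move=> mA; rewrite integral_mkcondr; apply: eq_integral => xi _.
by rewrite patchE /h indicE; case: ifP => _; rewrite ?mulr1 ?mulr0.
Qed.

Let mh : measurable_fun setT h.
Proof.
by apply: measurable_funM; [exact: (continuous_measurable_fun gc)|exact: measurable_indic].
Qed.

Let inth : mu.-integrable setT (EFin \o h).
Proof.
apply/integrableP; split; first exact/measurable_EFinP.
under eq_integral do rewrite /= ger0_norm//.
by rewrite integral_h// setTI integral_g ?ltry// lexx ltW.
Qed.

Let intk : mu.-integrable setT (EFin \o k).
Proof. exact: integrable_indic_itv. Qed.

Let mY : measurable_fun setT Y. Proof. exact: (continuous_measurable_fun Yc). Qed.

Notation hmu := (@density _ (measurableTypeR R) R mu h h_ge0 inth).
Notation kmu := (@density _ (measurableTypeR R) R mu k k_ge0 intk).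
Notation image_hmu :=
  (@image_measure _ _ (measurableTypeR R) (measurableTypeR R) R hmu Y mY).

(** By the fundamental theorem of calculus the preimage ]a, beta[ of a ray
    has mass [Y beta - Y a] for [g dxi], which is the length of the trace of
    the ray on the segment [Y a, Y b]. *)
Let image_hmu_ray c : image_hmu `]-oo, c[%classic = kmu `]-oo, c[%classic.
Proof.
transitivity (\int[mu]_(xi in Y @^-1` `]-oo, c[) (h xi)%:E)%E => //.
transitivity (mu (`[Y a, Y b] `&` `]-oo, c[)); last first.
  by rewrite -integral_indic.
rewrite integral_h; last first.
  by rewrite -[X in measurable X]setTI; exact: mY.
have [cYa|Yac] := leP c (Y a).
  rewrite (_ : Y @^-1` _ `&` _ = set0) ?integral_set0; last first.
    apply/seteqP; split=> // xi /= []; rewrite !in_itv/= => Yc' /andP[axi _].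
    by move: (lt_le_trans Yc' cYa); rewrite ltNge Ynd// ltW.
  rewrite (_ : `[Y a, Y b] `&` _ = set0) ?measure0//.
  apply/seteqP; split=> // y /= []; rewrite !in_itv/= => /andP[Yay _] yc.
  by move: (lt_le_trans yc cYa); rewrite ltNge Yay.
have [Ybc|cYb] := ltP (Y b) c.
  rewrite (_ : Y @^-1` _ `&` _ = `]a, b[%classic); last first.
    apply/seteqP; split=> xi /=; rewrite !in_itv/=; first by move=> [].
    move=> /andP[axi xib]; rewrite axi xib; split=> //.
    by apply: le_lt_trans Ybc; apply: Ynd; exact: ltW.
  rewrite (_ : `[Y a, Y b] `&` _ = `[Y a, Y b]%classic); last first.
    apply/seteqP; split=> y /=; rewrite !in_itv/=; first by move=> [].
    by move=> /andP[ay yb]; rewrite ay yb (le_lt_trans _ Ybc).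
  rewrite integral_g ?lexx ?ltW// lebesgue_measure_itv/= lte_fin.
  have : Y a <= Y b by apply: Ynd; exact: ltW.
  by rewrite le_eqVlt => /predU1P[->|->]; rewrite ?subrr ?ltxx.
have [beta [abb Yb YE]] := @first_hit c (introT andP (conj Yac cYb)).
rewrite (_ : Y @^-1` _ `&` _ = `]a, beta[%classic); last first.
  apply/seteqP; split=> xi /=; rewrite !in_itv/= YE.
    by move=> [-> /andP[-> _]].
  by move=> /andP[-> xb]; rewrite xb (lt_le_trans xb)//; case/andP: abb.
rewrite (_ : `[Y a, Y b] `&` _ = `[Y a, c[%classic); last first.
  apply/seteqP; split=> y /=; rewrite !in_itv/=.
    by move=> [/andP[-> _] ->].
  by move=> /andP[-> yc]; rewrite yc (le_trans (ltW yc)).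
by rewrite integral_g// Yb lebesgue_measure_itv/= lte_fin Yac.
Qed.

Let image_hmuE (A : set (measurableTypeR R)) : measurable A -> image_hmu A = kmu A.
Proof.
apply: (@measure_unique _ R (measurableTypeR R) (@RGenInftyO.G R)
  (fun n => `]-oo, n%:R[%classic) _ _ _ _ image_hmu kmu).
- exact: RGenInftyO.measurableE.
- move=> _ _ [c ->] [c' ->]; exists (Num.min c c').
  by apply/seteqP; split=> y /=; rewrite !in_itv/= lt_min => /andP.
- by move=> n; exists n%:R.
- apply/seteqP; split=> // y _; exists (Num.truncn y).+1 => //=.
  by rewrite in_itv/= truncnS_gt.
- by move=> _ [c ->]; exact: image_hmu_ray.
- move=> n; rewrite (le_lt_trans (le_measure _ _ _ (@subsetT _ _))) ?inE//.
  by rewrite -ge0_fin_numE// fin_num_measure.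
Qed.

Let restrict_k (f : R -> R) :
  (fun y => (f y * k y)%:E) = (fun y => (f y)%:E) \_ `[Y a, Y b].
Proof.
apply/funext => y; rewrite patchE /k indicE.
by case: ifP => _; rewrite ?mulr1 ?mulr0.
Qed.

Let restrict_h (f : R -> R) :
  (fun xi => (f (Y xi) * h xi)%:E) =
  (fun xi => (f (Y xi) * g xi)%:E) \_ `]a, b[.
Proof.
apply/funext => xi; rewrite patchE /h indicE.
by case: ifP => _; rewrite ?mulr1 ?mulr0.
Qed.

(** [Y] need not be injective: on a flat piece [g = 0], and the value of [f] at
    the corresponding point counts on neither side. *)
Lemma integral_nondecreasing_substitution (f : R -> R) :
  measurable_fun setT f ->
  (\int[mu]_(y in `[Y a, Y b]) (f y)%:E =
   \int[mu]_(xi in `]a, b[) (f (Y xi) * g xi)%:E)%E.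
Proof.
move=> mf; rewrite integral_mkcond [RHS]integral_mkcond -restrict_k -restrict_h.
rewrite -(@integral_density _ (measurableTypeR R) R mu k k_ge0 intk)//.
rewrite -(@integral_density _ (measurableTypeR R) R mu h h_ge0 inth); last first.
  exact: measurableT_comp.
rewrite -(@eq_measure_integral _ _ _ _ kmu image_hmu); last first.
  by move=> A mA _; exact: image_hmuE.
by rewrite integral_image_measure//; exact/measurable_EFinP.
Qed.

Lemma integrable_nondecreasing_substitution (f : R -> R) :
  measurable_fun setT f ->
  mu.-integrable `[Y a, Y b] (EFin \o f) <->
  mu.-integrable `]a, b[ (fun xi => (f (Y xi) * g xi)%:E).
Proof.
move=> mf; have mfY : measurable_fun setT (f \o Y) by exact: measurableT_comp.
have E : (\int[mu]_(y in `[Y a, Y b]) `|(f y)%:E| =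
          \int[mu]_(xi in `]a, b[) `|(f (Y xi) * g xi)%:E|)%E.
  rewrite (integral_nondecreasing_substitution (f := fun y => `|f y|)); last first.
    exact: measurableT_comp.
  by apply: eq_integral => xi _; rewrite abse_EFin normrM (ger0_norm (g_ge0 xi)).
split=> /integrableP[_ fi]; apply/integrableP; split.
- apply: measurable_funTS; apply/measurable_EFinP; apply: measurable_funM => //.
  exact: continuous_measurable_fun gc.
- by rewrite -E.
- exact/measurable_funTS/measurable_EFinP.
- by rewrite E.
Qed.

End NondecreasingSubstitution.

(** * The momentum of a potential *)

Section Momentum.
Context {R : realType}.
Notation mu := (@lebesgue_measure R).

(** The relation between [p'] and [q'] is variation of constants for the
    equation [v - v'' = r]: their contributions to [v'] cancel. *)
Lemma momentum_of_split (v p q r : R -> R) (x0 : R) :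
  (\forall x \near x0, v x = expR (- x) / 2 * p x + expR x / 2 * q x) ->
  (\forall x \near x0, is_derive (x : R) (1 : R) p (expR x * r x)) ->
  (\forall x \near x0, is_derive (x : R) (1 : R) q (- (expR (- x) * r x))) ->
  v x0 - derive1 (derive1 v) x0 = r x0.
Proof.
move=> vE pD qD.
have expN (x : R) : is_derive x (1 : R) (fun y : R => expR (- y)) (- expR (- x)).
  apply: is_derive_eq.
  by rewrite mulrN1.
have expK (x : R) : expR (- x) * expR x = 1.
  by rewrite expRN mulVf// gt_eqF ?expR_gt0.
(* [s = 1] differentiates [v], and [s = - 1] differentiates [v']. *)
have combD s (x : R) : is_derive x (1 : R) p (expR x * r x) ->
    is_derive x (1 : R) q (- (expR (- x) * r x)) ->
    is_derive x (1 : R)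
      (fun y : R => s * (expR (- y) / 2 * p y) + expR y / 2 * q y)
      (- s * (expR (- x) / 2 * p x) + expR x / 2 * q x + (s - 1) / 2 * r x).
  move=> pDx qDx; have eN := expN x.
  apply: is_derive_eq; rewrite /GRing.scale/=.
  have := expK x; move: (expR (- x)) (expR x) => e1 e2 e12.
  rewrite [X in _ = _ + _ * X](_ : r x = e1 * e2 * r x).
    by field.
  by rewrite e12 mul1r.
have v1 : \forall x \near x0,
    derive1 v x = - 1 * (expR (- x) / 2 * p x) + expR x / 2 * q x.
  have vE' := near_join vE.
  near=> x; rewrite derive1E; apply: derive_val.
  apply: (@near_eq_is_derive _ _ _
    (fun y : R => 1 * (expR (- y) / 2 * p y) + expR y / 2 * q y)).
    have : \forall y \near x, v y = expR (- y) / 2 * p y + expR y / 2 * q y.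
      by near: x.
    by apply: filterS => y ->; rewrite mul1r.
  apply: is_derive_eq; first (apply: combD; by near: x).
  by rewrite subrr !mul0r addr0.
rewrite (nbhs_singleton vE) derive1E (near_eq_derive _ v1).
have h := combD (- 1) x0 (nbhs_singleton pD) (nbhs_singleton qD).
by rewrite (@derive_val _ _ _ _ _ _ _ h); field.
Unshelve. all: by end_near. Qed.

End Momentum.

Section Transport.
Context {R : realType}.
Notation mu := (@lebesgue_measure R).
Variables (a b : R) (Y g f : R -> R).
Hypothesis Yc : continuous Y.
Hypothesis Ynd : {homo Y : x y / x <= y}.
Hypothesis Yd : forall xi, a < xi < b -> is_derive (xi : R) (1 : R) Y (g xi).
Hypothesis gc : continuous g.
Hypothesis fc : continuous f.
Hypothesis f0 : forall xi, ~~ (a < xi < b) -> f xi = 0.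

(** The labels near which [Y] is a local diffeomorphism. *)
Definition regular : set R := [set xi | a < xi < b /\ 0 < g xi].

Lemma open_regular : open regular.
Proof.
have -> : regular = `]a, b[ `&` (g @^-1` `]0, +oo[).
  by apply/seteqP; split=> xi /=; rewrite !in_itv/= andbT.
apply: openI; first exact: interval_open.
by apply: open_comp; [move=> *; exact: gc | exact: interval_open].
Qed.

(* [Y] is compared with its tangent at [xi], and its monotonicity propagates
   the resulting strict inequalities to all labels. *)
Let slope_gt0 xi : regular xi -> exists2 e : R, 0 < e &
  forall h, h != 0 -> `|h| < e -> 0 < h^-1 * (Y (h + xi) - Y xi).
Proof.
move=> [/Yd[dY gE] gxi].
have [/= e e0 eP] : \forall h \near (0 : R)^',
    0 < h^-1 *: (Y (h *: (1 : R) + xi) - Y xi).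
  by apply: (cvgr_gt (g xi)) => //; rewrite -gE; exact: dY.
exists e => // h h0 he; have := eP h; rewrite /= sub0r normrN /GRing.scale/= mulr1.
exact.
Qed.

Lemma regular_lt xi eta : regular xi -> xi < eta -> Y xi < Y eta.
Proof.
move=> /slope_gt0[e e0 slope] xieta.
pose h := Num.min (e / 2) (eta - xi).
have h0 : 0 < h by rewrite lt_min divr_gt0//= subr_gt0.
have he : `|h| < e by rewrite gtr0_norm// gt_min gtr_pMr// invf_lt1// ltr1n.
have := slope h (lt0r_neq0 h0) he.
rewrite pmulr_rgt0 ?invr_gt0// subr_gt0 => /lt_le_trans; apply.
by apply: Ynd; rewrite -lerBrDr ge_min lexx orbT.
Qed.

Lemma regular_gt xi eta : regular xi -> eta < xi -> Y eta < Y xi.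
Proof.
move=> /slope_gt0[e e0 slope] xieta.
pose h := Num.max (- (e / 2)) (eta - xi).
have h0 : h < 0 by rewrite gt_max oppr_lt0 divr_gt0//= subr_lt0.
have he : `|h| < e.
  by rewrite ltr0_norm// ltrNl lt_max ltrN2 gtr_pMr// invf_lt1// ltr1n.
have := slope h (ltr0_neq0 h0) he.
rewrite nmulr_rgt0 ?invr_lt0// subr_lt0; apply: le_lt_trans.
by apply: Ynd; rewrite -lerBlDr le_max lexx orbT.
Qed.

Lemma regular_inj xi eta : regular xi -> Y eta = Y xi -> eta = xi.
Proof.
move=> Vxi Yeta; apply/eqP; rewrite eq_le !leNgt; apply/andP; split; apply/negP.
- by move=> /(regular_lt Vxi); rewrite Yeta ltxx.
- by move=> /(regular_gt Vxi); rewrite Yeta ltxx.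
Qed.

(** By the intermediate value theorem, the image of a small segment around a
    regular label contains a neighbourhood of the image of that label. *)
Lemma open_image_regular (W : set R) : open W -> W `<=` regular -> open (Y @` W).
Proof.
rewrite !openE => oW WV _ [xi Wxi <-]; have Vxi := WV _ Wxi.
have [/= e e0 eW] := oW _ Wxi.
have e2 : 0 < e / 2 by rewrite divr_gt0.
have lo : Y (xi - e / 2) < Y xi by apply: regular_gt => //; rewrite gtrBl.
have hi : Y xi < Y (xi + e / 2) by apply: regular_lt => //; rewrite ltrDl.
have : Y xi \in `]Y (xi - e / 2), Y (xi + e / 2)[ by rewrite in_itv/= lo.
move/near_in_itvoo; apply: filterS => y; rewrite in_itv/= => /andP[ylo yhi].
have [|||z zI <-] := @IVT _ Y (xi - e / 2) (xi + e / 2) y.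
- by rewrite lerD2l ge0_cp// ltW.
- exact: continuous_subspaceT.
- have Ylh : Y (xi - e / 2) <= Y (xi + e / 2) by exact/ltW/(lt_trans lo).
  by rewrite (min_idPl Ylh) (max_idPr Ylh) !ltW.
exists z => //; apply: eW => /=.
move: zI; rewrite in_itv/= => /andP[zl zr].
rewrite ltr_distlC; apply/andP; split.
- by apply: lt_le_trans zl; rewrite ltrD2l ltrN2 gtr_pMr// invf_lt1// ltr1n.
- by apply: le_lt_trans zr _; rewrite ltrD2l gtr_pMr// invf_lt1// ltr1n.
Qed.

(** The inverse of [Y] on the image of [regular]; elsewhere its value is the
    default [0]. *)
Definition label (x : R) : R := xget 0 [set xi | regular xi /\ Y xi = x].

Lemma labelK xi : regular xi -> label (Y xi) = xi.
Proof.
move=> Vxi; rewrite /label; case: xgetP => [eta _ [Veta]|].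
  by move/(regular_inj Vxi).
by move/(_ xi); case; split.
Qed.

Lemma is_derive_label xi : regular xi ->
  is_derive (Y xi) (1 : R) label (g xi)^-1.
Proof.
move=> Vxi; apply: is_derive_inverse.
- near=> eta; apply: labelK; near: eta.
  exact: open_nbhs_nbhs (conj open_regular Vxi).
- by near=> eta; exact: Yc.
- by apply: Yd; case: Vxi.
- by case: Vxi => _ /lt0r_neq0.
Unshelve. all: by end_near. Qed.

Lemma integrable_continuousM (w : R -> R) : continuous w ->
  mu.-integrable setT (fun xi => (w xi * f xi)%:E).
Proof.
move=> wc.
have intab : mu.-integrable `[a, b] (EFin \o (fun xi => w xi * f xi)).
  apply: continuous_compact_integrable; first exact: segment_compact.
  by apply: continuous_subspaceT => xi; apply: cvgM; [exact: wc|exact: fc].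
have mab : measurable (`[a, b]%classic : set (measurableTypeR R)) by [].
have := (integrable_mkcond _ mab).1 intab.
apply: eq_integrable => // xi _.
rewrite patchE; case: ifPn => // xiab; rewrite f0 ?mulr0//.
apply: contra xiab => /andP[axi xib].
by rewrite inE/= in_itv/= !ltW.
Qed.

Definition potential (x : R) : R :=
  \int[mu]_(th in `[a, b]) (G (x - Y th) * f th).

(* [P] and [Qtot - Q] are the masses of [e^Y f] to the left and of [e^-Y f] to
   the right of a label; [f] vanishes outside of ]a, b[. *)
Let P xi := \int[mu]_(th in `]-oo, xi]) (expR (Y th) * f th).
Let Q xi := \int[mu]_(th in `]-oo, xi]) (expR (- Y th) * f th).
Let Qtot := \int[mu]_th (expR (- Y th) * f th).

Let expYc : continuous (fun th => expR (Y th)).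
Proof. by move=> th; apply: continuous_comp; [exact: Yc|exact: continuous_expR]. Qed.

Let expNYc : continuous (fun th => expR (- Y th)).
Proof.
move=> th; apply: continuous_comp; last exact: continuous_expR.
by apply: continuousN; exact: Yc.
Qed.

(** Only the labels in ]a, b[ carry mass, so that the hypotheses can be met
    with [xi = b] or [xi = a] when [x] lies to the right or to the left of the
    range of [Y]. *)
Lemma potential_split x xi :
  (forall th, a < th < b -> th <= xi -> Y th <= x) ->
  (forall th, a < th < b -> xi < th -> x <= Y th) ->
  potential x = expR (- x) / 2 * P xi + expR x / 2 * (Qtot - Q xi).
Proof.
move=> left_le right_ge.
have -> : potential x = \int[mu]_th (G (x - Y th) * f th).
  rewrite /potential Rintegral_mkcond; apply: eq_Rintegral => th _.
  rewrite patchE; case: ifPn => // thab; rewrite f0 ?mulr0//.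
  apply: contra thab => /andP[ath thb].
  by rewrite inE/= in_itv/= !ltW.
have intG : mu.-integrable setT (fun th => (G (x - Y th) * f th)%:E).
  apply: (integrable_continuousM (w := fun th => G (x - Y th))) => th.
  apply: cvgM; last exact: cvg_cst.
  apply: continuous_comp; last exact: continuous_expR.
  apply: continuousN; apply: continuous_comp; last exact: norm_continuous.
  by apply: continuousB; [exact: cvg_cst|exact: Yc].
have -> : [set: measurableTypeR R] = `]-oo, xi] `|` `]xi, +oo[.
  by rewrite -set_itvNyy; apply: itv_bndbnd_setU.
rewrite Rintegral_setU//; last 2 first.
  by rewrite -itv_bndbnd_setU// set_itvNyy.
  apply/disj_setPS => th [] /=; rewrite !in_itv/= andbT => thxi.
  by rewrite ltNge thxi.
congr (_ + _).
  rewrite -RintegralZl//; last first.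
    by apply: (integrableS measurableT) => //; exact: integrable_continuousM.
  apply: eq_Rintegral => th; rewrite inE/= in_itv/= => thxi.
  have [thab|/f0 ->] := boolP (a < th < b); last by rewrite !mulr0.
  rewrite /G ger0_norm ?subr_ge0 ?left_le// opprB expRD; ring.
rewrite /Qtot -set_itvNyy Rintegral_itvB//; last first.
  by rewrite set_itvNyy; exact: integrable_continuousM.
rewrite -RintegralZl//; last first.
  by apply: (integrableS measurableT) => //; exact: integrable_continuousM.
apply: eq_Rintegral => th; rewrite inE/= in_itv/= andbT => thxi.
have [thab|/f0 ->] := boolP (a < th < b); last by rewrite !mulr0.
rewrite /G ler0_norm ?subr_le0 ?right_ge// opprK expRD; ring.
Qed.

Let is_derive_primitive (w : R -> R) (xi : R) : continuous w ->
  is_derive xi (1 : R) (fun z => \int[mu]_(th in `]-oo, z]) (w th * f th))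
    (w xi * f xi).
Proof.
move=> wc.
have intw : mu.-integrable [set` `]-oo, xi + 1]] (EFin \o (fun th => w th * f th)).
  by apply: (integrableS measurableT) => //; exact: integrable_continuousM.
have [|||dP PE] := @continuous_FTC1 R _ -oo%O xi (xi + 1) _ intw.
- by rewrite ltrDl.
- by rewrite /Order.lt/=.
- by apply: continuousM; [exact: wc|exact: fc].
by split; rewrite ?PE// -derive1E PE.
Qed.

Definition potential_momentum x := potential x - derive1 (derive1 potential) x.

(** Conservation of the momentum along the flow, [m(Y xi) g xi = f xi], read off
    the representation of the potential.  It holds at the final time as well,
    at the labels where the flow has not degenerated. *)
Lemma momentum_regular xi : regular xi -> potential_momentum (Y xi) = f xi / g xi.
Proof.
move=> Vxi; have oY := open_image_regular open_regular (@subset_refl _ _).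
have YVxi : \forall x \near Y xi, (Y @` regular) x.
  by apply: open_nbhs_nbhs; split=> //; exists xi.
rewrite /potential_momentum (@momentum_of_split _ _ (P \o label)
  (fun x => Qtot - Q (label x)) (fun x => f (label x) / g (label x))).
- by rewrite labelK.
- apply: filterS YVxi => _ [eta Veta <-]; rewrite /= labelK//.
  by apply: potential_split => th _ h; apply: Ynd => //; exact: ltW.
- apply: filterS YVxi => _ [eta Veta <-]; rewrite labelK//.
  have dl := is_derive_label Veta.
  have dP : is_derive (label (Y eta)) (1 : R) P (expR (Y eta) * f eta).
    by rewrite labelK//; exact: is_derive_primitive expYc.
  apply: is_derive_eq.
  by rewrite mulrA.
- apply: filterS YVxi => _ [eta Veta <-]; rewrite labelK//.
  have dl := is_derive_label Veta.
  have dQ : is_derive (label (Y eta)) (1 : R) Q (expR (- Y eta) * f eta).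
    by rewrite labelK//; exact: is_derive_primitive expNYc.
  have dQl := is_derive1_comp dQ dl.
  apply: is_derive_eq.
  by rewrite add0r mul1r mulrA.
Qed.

Lemma momentum_right x : Y b < x -> potential_momentum x = 0.
Proof.
move=> Ybx; rewrite /potential_momentum (@momentum_of_split _ _ (fun=> P b)
  (fun=> Qtot - Q b) (fun=> 0))//.
- have : \forall z \near x, Y b < z by exact: lt_nbhsr.
  apply: filterS => z Ybz; apply: potential_split => th /andP[_ thb].
    by move=> _; apply: le_trans (ltW Ybz); apply: Ynd; exact: ltW.
  by move=> /(lt_trans thb); rewrite ltxx.
- by near=> z; apply: is_derive_eq; rewrite mulr0.
- by near=> z; apply: is_derive_eq; rewrite mulr0 oppr0.
Unshelve. all: by end_near. Qed.

Lemma momentum_left x : x < Y a -> potential_momentum x = 0.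
Proof.
move=> xYa; rewrite /potential_momentum (@momentum_of_split _ _ (fun=> P a)
  (fun=> Qtot - Q a) (fun=> 0))//.
- have : \forall z \near x, z < Y a by exact: lt_nbhsl.
  apply: filterS => z zYa; apply: potential_split => th /andP[ath _].
    by move=> tha; move: (lt_le_trans ath tha); rewrite ltxx.
  by move=> _; apply: (le_trans (ltW zYa)); apply: Ynd; exact: ltW.
- by near=> z; apply: is_derive_eq; rewrite mulr0.
- by near=> z; apply: is_derive_eq; rewrite mulr0 oppr0.
Unshelve. all: by end_near. Qed.

End Transport.

(** * The law of the momentum on the regular set *)

Lemma integrable_boundedM d (T : measurableType d) (R : realType)
    (mu : {measure set T -> \bar R}) (h f : T -> R) :
  measurable_fun setT h -> (exists M, forall x, `|h x| <= M) ->
  mu.-integrable setT (EFin \o f) ->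
  mu.-integrable setT (fun x => (h x * f x)%:E).
Proof.
move=> mh [M hM] intf; apply: (integrableMr measurableT mh _ intf).
exists M; split; first exact: num_real.
by move=> z Mz x _ /=; exact: le_trans (hM x) (ltW Mz).
Qed.

Section TransportLaw.
Context {R : realType}.
Notation mu := (@lebesgue_measure R).
Variables (a b : R) (Y g f : R -> R).
Hypothesis ab : a < b.
Hypothesis Yc : continuous Y.
Hypothesis Ynd : {homo Y : x y / x <= y}.
Hypothesis Yd : forall xi, a < xi < b -> is_derive (xi : R) (1 : R) Y (g xi).
Hypothesis gc : continuous g.
Hypothesis g_ge0 : forall xi, 0 <= g xi.
Hypothesis fc : continuous f.
Hypothesis f0 : forall xi, ~~ (a < xi < b) -> f xi = 0.

Notation V := (regular a b g).
Notation O := (Y @` V).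

Definition regular_momentum (x : R) : R :=
  if x \in O then potential_momentum a b Y f x else 0.

Let regular_momentumE xi : V xi -> regular_momentum (Y xi) = f xi / g xi.
Proof.
move=> Vxi; rewrite /regular_momentum mem_set; last by exists xi.
exact: momentum_regular.
Qed.

Let openO : open O.
Proof. by apply: open_image_regular => //; exact: open_regular. Qed.

(** On the open image of the regular labels the momentum is [f / g] read at the
    label, hence continuous. *)
Lemma measurable_regular_momentum : measurable_fun setT regular_momentum.
Proof.
pose h x := f (label a b Y g x) / g (label a b Y g x).
have -> : regular_momentum = h \_ O.
  apply/funext => x; rewrite patchE; case: ifPn => [|xO].
    by rewrite inE => -[xi Vxi <-]; rewrite regular_momentumE// /h labelK.
  by rewrite /regular_momentum (negbTE xO).
apply/(measurable_restrictT h); first exact: (open_measurable openO).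
apply: open_continuous_measurable_fun => // x; rewrite inE => -[xi Vxi <-].
have lc : {for Y xi, continuous (label a b Y g)}.
  apply: differentiable_continuous; apply/derivable1_diffP.
  by have [] := is_derive_label Yc Ynd Yd gc Vxi.
apply: cvgM.
- by apply: continuous_comp lc _; exact: fc.
- apply: cvgV; first by rewrite labelK//; case: Vxi => _ /lt0r_neq0.
  by apply: continuous_comp lc _; exact: gc.
Qed.

Variable phi : R -> R.
Hypothesis mphi : measurable_fun setT phi.
Hypothesis bphi : exists M, forall x, `|phi x| <= M.

Let F y := phi y * regular_momentum y.

Let mF : measurable_fun setT F.
Proof. by apply: measurable_funM => //; exact: measurable_regular_momentum. Qed.

Let F_restrict : EFin \o F = (EFin \o F) \_ `[Y a, Y b].
Proof.
apply/funext => y; rewrite patchE; case: ifPn => // yab.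
rewrite /= /F /regular_momentum ifF ?mulr0//; apply: contraNF yab.
rewrite inE => -[xi [/andP[axi xib] _] <-].
by rewrite inE/= in_itv/= !Ynd// ltW.
Qed.

(* [g] vanishes at the labels in ]a, b[ that are not regular. *)
Let F_pullback : {in `]a, b[%classic, (fun xi => (F (Y xi) * g xi)%:E) =1
  (fun xi => (phi (Y xi) * f xi)%:E) \_ V}.
Proof.
move=> xi; rewrite inE/= in_itv/= => xiab; rewrite patchE; case: ifPn => xiV.
  move: xiV; rewrite inE => Vxi; rewrite /F regular_momentumE//.
  by rewrite -mulrA divfK//; case: Vxi => _ /lt0r_neq0.
suff -> : g xi = 0 by rewrite mulr0.
apply/eqP; rewrite eq_le g_ge0 andbT leNgt; apply: contra xiV => gxi.
by rewrite inE.
Qed.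

Lemma integral_regular_momentum :
  (\int[mu]_x (phi x * regular_momentum x)%:E =
   \int[mu]_(xi in V) (phi (Y xi) * f xi)%:E)%E.
Proof.
rewrite -[LHS]/(\int[mu]_x (EFin \o F) x)%E F_restrict -integral_mkcond.
rewrite (integral_nondecreasing_substitution ab Yc Ynd Yd gc g_ge0 mF).
transitivity (\int[mu]_(xi in `]a, b[)
    ((fun xi => (phi (Y xi) * f xi)%:E) \_ V) xi)%E.
  by apply: eq_integral => xi /F_pullback.
rewrite -integral_mkcondr setIidr// => xi [xiab _].
by rewrite /= in_itv.
Qed.

Lemma integrable_regular_momentum :
  mu.-integrable setT (fun x => (phi x * regular_momentum x)%:E).
Proof.
have mab : measurable (`]a, b[%classic : set (measurableTypeR R)) by [].
have mE : measurable (`[Y a, Y b]%classic : set (measurableTypeR R)) by [].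
have mV : measurable (V : set (measurableTypeR R)).
  by apply: open_measurable; exact: open_regular.
suff : mu.-integrable `[Y a, Y b] (EFin \o F).
  by move/(integrable_mkcond _ mE); rewrite -F_restrict.
apply/(integrable_nondecreasing_substitution ab Yc Ynd Yd gc g_ge0 mF).
apply: (eq_integrable mab ((fun xi => (phi (Y xi) * f xi)%:E) \_ V)).
  by move=> xi /F_pullback ->.
apply/(@integrable_restrict _ _ _ mu _ mV _ mab).
apply: (integrableS measurableT) => //; first exact: measurableI.
apply: integrable_boundedM.
- by apply: measurableT_comp => //; exact: continuous_measurable_fun Yc.
- by have [M phiM] := bphi; exists M.
- have := integrable_continuousM fc f0 (@cst_continuous R R (1 : R)).
  by apply: eq_integrable => // xi _; rewrite /= mul1r.
Qed.

End TransportLaw.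

(** * Charges and compactly supported functions *)

Lemma sube_eqD (R : realDomainType) (x y z w : \bar R) :
  x \is a fin_num -> y \is a fin_num -> z \is a fin_num -> w \is a fin_num ->
  (x - y = z - w)%E <-> (x + w = z + y)%E.
Proof.
move: x y z w => [x||] [y||] [z||] [w||]// _ _ _ _.
by rewrite -!EFinN -!EFinD; split=> -[h]; congr EFin; lra.
Qed.

Section Charges.
Context {R : realType}.
Notation mR := (measurableTypeR R).

(** A ramp up on the right of [a] and a ramp down on the right of [b], both of
    slope [n + 1]: this asymmetry is what makes the limit the indicator of the
    interval ]a, b], and such intervals generate the Borel sets. *)
Definition trapezoid (a b : R) (n : nat) (x : R) : R :=
  Num.max 0 (Num.min 1 (n.+1%:R * (x - a))) *
  Num.max 0 (Num.min 1 (1 - n.+1%:R * (x - b))).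

Lemma trapezoid_continuous a b n : continuous (trapezoid a b n).
Proof.
have c (h : R -> R) : continuous h ->
    continuous (fun x => Num.max 0 (Num.min 1 (h x))).
  move=> hc x.
  apply: (@continuous_max R R (fun=> 0) (fun x => Num.min 1 (h x)) x).
    exact: cst_continuous.
  apply: (@continuous_min R R (fun=> 1) h x); [exact: cst_continuous|exact: hc].
have l (z : R) : continuous (fun x => n.+1%:R * (x - z)).
  move=> x; apply: cvgM; first exact: cvg_cst.
  by apply: cvgB; [exact: cvg_id|exact: cvg_cst].
have l1 : continuous (fun x => 1 - n.+1%:R * (x - b)).
  by move=> x; apply: cvgB; [exact: cvg_cst|exact: l].
by move=> x; apply: cvgM; [exact: (c _ (l a))|exact: (c _ l1)].
Qed.

Lemma trapezoid_bound a b n x : `|trapezoid a b n x| <= 1.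
Proof.
have c (y : R) : 0 <= Num.max 0 (Num.min 1 y) <= 1.
  by rewrite le_max lexx/= ge_max ler01 ge_min lexx.
have /andP[u0 u1] := c (n.+1%:R * (x - a)).
have /andP[v0 v1] := c (1 - n.+1%:R * (x - b)).
by rewrite ger0_norm ?mulr_ge0// mulr_ile1.
Qed.

Lemma trapezoid_Cc a b n : Cc (trapezoid a b n).
Proof.
split; first exact: trapezoid_continuous.
apply: (@subclosed_compact _ _ `[a, b + 1]%classic).
- exact: closed_closure.
- exact: segment_compact.
have /closure_id -> : closed `[a, b + 1]%classic by exact: interval_closed.
apply: closureS => x /=; rewrite in_itv/= => tx; apply/andP; split.
- rewrite leNgt; apply/negP => xa; move/eqP: tx; apply.
  rewrite /trapezoid [X in X * _]max_l ?mul0r// ge_min; apply/orP; right.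
  by rewrite pmulr_rle0// subr_le0 ltW.
- rewrite leNgt; apply/negP => bx; move/eqP: tx; apply.
  rewrite /trapezoid [X in _ * X]max_l ?mulr0// ge_min; apply/orP; right.
  rewrite subr_le0 (@le_trans _ _ (x - b))//; first by rewrite lerBrDl ltW.
  by rewrite ler_peMl ?ler1n// subr_ge0 (le_trans _ (ltW bx))// lerDl.
Qed.

Let eventually_ge1 (y : R) : 0 < y -> \forall n \near \oo, 1 <= n.+1%:R * y.
Proof.
move=> y0; near=> n; rewrite -ler_pdivrMr// mul1r (@le_trans _ _ n%:R)//.
  by near: n; exact: nbhs_infty_ger.
by rewrite ler_nat.
Unshelve. all: by end_near. Qed.

Lemma trapezoid_cvg a b x :
  trapezoid a b n x @[n --> \oo] --> (\1_`]a, b] x : R).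
Proof.
apply: cvg_near_cst; rewrite indicE.
have [xa|ax] := leP x a.
  apply: nearW => n; rewrite memNset ?in_itv /= ?ltNge ?xa//; last first.
    by rewrite in_itv/= ltNge xa.
  rewrite /trapezoid [X in X * _]max_l ?mul0r// ge_min; apply/orP; right.
  by rewrite pmulr_rle0// subr_le0.
have [xb|bx] := leP x b.
  rewrite mem_set; last by rewrite /= in_itv/= ax.
  near=> n.
  have n1 : 1 <= n.+1%:R * (x - a).
    by near: n; apply: eventually_ge1; rewrite subr_gt0.
  rewrite /trapezoid min_l// max_r// mul1r min_l ?max_r//.
  by rewrite lerBrDr gerDl pmulr_rle0// subr_le0.
rewrite memNset; last by rewrite /= in_itv/= ax leNgt bx.
near=> n.
have n1 : 1 <= n.+1%:R * (x - b).
  by near: n; apply: eventually_ge1; rewrite subr_gt0.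
by rewrite /trapezoid [X in _ * X]max_l ?mulr0// ge_min subr_le0 n1 orbT.
Unshelve. all: by end_near. Qed.

Lemma Rintegral_trapezoid_cvg (m : {finite_measure set mR -> \bar R}) a b :
  \int[m]_x trapezoid a b n x @[n --> \oo] --> fine (m `]a, b]%classic).
Proof.
have mt n : measurable_fun setT (trapezoid a b n).
  exact: continuous_measurable_fun (@trapezoid_continuous a b n).
have -> : m `]a, b]%classic = (\int[m]_x (\1_`]a, b] x)%:E)%E.
  by rewrite integral_indic ?setIT.
apply: fine_cvg; rewrite fineK; last first.
  by rewrite integral_indic ?setIT//; exact: fin_num_measure.
apply: (@dominated_cvg _ _ _ m _ _ (fun n x => (trapezoid a b n x)%:E) _
  (EFin \o cst 1)) => //.
- by move=> n; apply/measurable_EFinP; exact: mt.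
- move=> x _; apply: cvg_EFin; first exact: nearW.
  exact: trapezoid_cvg.
- exact: finite_measure_integrable_cst.
- by move=> n x _; rewrite lee_fin trapezoid_bound.
Qed.

(** Trapezoids give the equality on the intervals ]a, b]; moving the negative
    terms to the other side makes it an equality of two finite measures, which
    extends to all Borel sets. *)
Lemma Cc_differences_unique (p n p' n' : {finite_measure set mR -> \bar R}) :
  (forall phi : R -> R, Cc phi ->
    \int[p]_x phi x - \int[n]_x phi x = \int[p']_x phi x - \int[n']_x phi x) ->
  forall A : set mR, measurable A -> (p A - n A = p' A - n' A)%E.
Proof.
move=> E.
have finE (m : {finite_measure set mR -> \bar R}) (A : set mR) :
    measurable A -> m A = (fine (m A))%:E.
  by move=> mA; rewrite fineK// fin_num_measure.
have Eoc a b : (p `]a, b]%classic - n `]a, b]%classic =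
                p' `]a, b]%classic - n' `]a, b]%classic)%E.
  rewrite (finE p)// (finE n)// (finE p')// (finE n')//; congr EFin.
  have cvg_diff (m1 m2 : {finite_measure set mR -> \bar R}) :
      \int[m1]_x trapezoid a b k x - \int[m2]_x trapezoid a b k x
        @[k --> \oo] --> fine (m1 `]a, b]%classic) - fine (m2 `]a, b]%classic).
    by apply: cvgB; exact: Rintegral_trapezoid_cvg.
  have := cvg_diff p n.
  rewrite [X in X @ _ --> _](_ : _ = fun k =>
    \int[p']_x trapezoid a b k x - \int[n']_x trapezoid a b k x).
    by move=> h; exact: (cvg_unique _ h (cvg_diff p' n')).
  by apply/funext => k; exact: E (trapezoid_Cc a b k).
suff S (A : set mR) : measurable A -> measure_add p n' A = measure_add p' n A.
  move=> A mA; apply/sube_eqD; rewrite ?fin_num_measure//.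
  by have := S A mA; rewrite !measure_addE.
apply: (@measure_unique _ R mR (@ocitv R) (fun k => `](- k%:R), k%:R]%classic)).
- by [].
- exact: ocitvI.
- by move=> k; exact: is_ocitv.
- apply/seteqP; split=> // x _; exists (Num.truncn `|x|).+1 => //=.
  rewrite in_itv/=; have : `|x| < (Num.truncn `|x|).+1%:R by rewrite truncnS_gt.
  by rewrite ltr_norml => /andP[-> /ltW].
- move=> _ [[a b] _ <-] /=; rewrite [LHS]measure_addE [RHS]measure_addE.
  apply/sube_eqD; rewrite ?fin_num_measure//.
  exact: Eoc.
- move=> k; rewrite [ltLHS]measure_addE lte_add_pinfty//.
  + by rewrite -ge0_fin_numE// fin_num_measure.
  + by rewrite -ge0_fin_numE// fin_num_measure.
Qed.

Local Notation Hahn nu := (projT2 (cid (projT2 (cid (Hahn_decomposition nu))))).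

Lemma charge_integral_unique (nu nu' : {charge set mR -> \bar R}) :
  (forall phi, Cc phi -> charge_integral nu phi = charge_integral nu' phi) ->
  forall A : set mR, measurable A -> nu A = nu' A.
Proof.
move=> E A mA.
have jd (ka : {charge set mR -> \bar R}) :
    (ka A = jordan_pos (Hahn ka) A - jordan_neg (Hahn ka) A)%E.
  by rewrite (jordan_decomp (Hahn ka) mA) /cadd/= cscaleN1.
rewrite (jd nu) (jd nu').
exact: (@Cc_differences_unique (jordan_pos (Hahn nu)) (jordan_neg (Hahn nu))
  (jordan_pos (Hahn nu')) (jordan_neg (Hahn nu'))).
Qed.

(** [charge_integral] refers to an unspecified Hahn decomposition; any other
    decomposition of the charge as a difference of finite measures gives the
    same integral. *)
Lemma charge_integralE (nu : {charge set mR -> \bar R})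
    (p n : {finite_measure set mR -> \bar R}) (phi : R -> R) :
  (forall A : set mR, measurable A -> nu A = (p A - n A)%E) ->
  measurable_fun setT phi -> (exists M, forall x, `|phi x| <= M) ->
  charge_integral nu phi = \int[p]_x phi x - \int[n]_x phi x.
Proof.
move=> nuE mphi bphi.
have intphi (m : {finite_measure set mR -> \bar R}) : m.-integrable setT (EFin \o phi).
  have := @integrable_boundedM _ mR R m phi (cst 1) mphi bphi
    (@finite_measure_integrable_cst _ _ _ m _ 1 measurableT).
  by apply: eq_integrable => // x _; rewrite /= mulr1.
have finI (m : {finite_measure set mR -> \bar R}) :
    (\int[m]_x (phi x)%:E)%E \is a fin_num.
  by apply: integrable_fin_num => //; exact: intphi.
rewrite /charge_integral/=.
set jp := jordan_pos _; set jn := jordan_neg _.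
have addE (A : set mR) : measurable A -> measure_add jp n A = measure_add p jn A.
  move=> mA; rewrite !measure_addE; have := nuE A mA.
  rewrite (jordan_decomp (Hahn nu) mA) /cadd/= cscaleN1 -/jp -/jn.
  by move/sube_eqD; rewrite ?fin_num_measure//; exact.
have : (\int[measure_add jp n]_x (phi x)%:E =
        \int[measure_add p jn]_x (phi x)%:E)%E.
  by apply: eq_measure_integral => A mA _; exact: addE.
rewrite !integral_measure_add//; try exact: intphi.
move/sube_eqD => /(_ (finI _) (finI _) (finI _) (finI _)) e.
rewrite /Rintegral -!fineB ?finI//.
by rewrite e.
Qed.

End Charges.

(** * The flow extended to the whole plane *)

(** Composing a function that is continuous within [A] with a retraction onto
    [A] replaces continuity within a rectangle by plain continuity. *)
Lemma continuous_retract (T U : topologicalType) (A : set T) (f : T -> U)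
    (r : T -> T) :
  {within A, continuous f} -> continuous r -> (forall z, A (r z)) ->
  continuous (f \o r).
Proof.
move=> /subspace_continuousP fA rc rA z.
apply: cvg_trans (fA (r z) (rA z)).
move=> N fN; have : nbhs (r z) [set y | A y -> N (f y)] by exact: fN.
move=> /(rc z); apply: (@filterS _ (nbhs z)) => y /=; apply.
exact: rA.
Qed.

Section Clamp.
Context {R : realType}.

Definition clamp (a b x : R) : R := Num.max a (Num.min b x).

Lemma clamp_continuous a b : continuous (clamp a b).
Proof.
move=> x.
apply: (@continuous_max R R (fun=> a) (fun x => Num.min b x) x).
  exact: cst_continuous.
by apply: (@continuous_min R R (fun=> b) id x); [exact: cst_continuous|exact: cvg_id].
Qed.

Lemma clamp_itv a b x : a <= b -> a <= clamp a b x <= b.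
Proof. by move=> ab; rewrite /clamp le_max lexx ge_max ab ge_min lexx. Qed.

Lemma clamp_id a b x : a <= x <= b -> clamp a b x = x.
Proof. by move=> /andP[ax xb]; rewrite /clamp min_r// max_r. Qed.

Lemma clamp_homo a b : {homo clamp a b : x y / x <= y}.
Proof.
move=> x y xy; rewrite /clamp ge_max !le_max lexx/=.
by rewrite le_min !ge_min lexx xy !orbT.
Qed.

End Clamp.

Lemma Cc_bounded (R : realType) (phi : R -> R) : Cc phi ->
  exists M, forall x, `|phi x| <= M.
Proof.
move=> [phic cphi].
have nphic : {within supp phi, continuous (fun x => `|phi x|)}.
  apply: continuous_subspaceT => x; apply: continuous_comp; first exact: phic.
  exact: norm_continuous.
have out x : ~ supp phi x -> phi x = 0.
  by move=> sx; apply/eqP; apply: contra_notT sx => px; exact: subset_closure.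
have [s0|/set0P s0] := eqVneq (supp phi) set0.
  by exists 0 => x; rewrite out ?normr0// s0.
have [c _ cmax] := compact_EVT_max s0 cphi nphic.
exists `|phi c| => x; have [sx|sx] := pselect (supp phi x).
  by apply: cmax; rewrite inE.
by rewrite out// normr0.
Qed.

Section Flow.
Context {R : realType}.
Notation mu := (@lebesgue_measure R).
Variables (L T : R) (m0 : R -> R) (X Xxi Xxixi Xt : R -> R -> R).
Hypothesis L0 : 0 < L.
Hypothesis T0 : 0 < T.
Hypothesis m0C1c : C1c (- L) L m0.
Hypothesis flowX : is_flow L m0 T X Xxi Xxixi Xt.

Let Lle : - L <= L. Proof. by rewrite ge0_cp// ltW. Qed.
Let Llt : - L < L. Proof. by rewrite (@lt_trans _ _ 0)// oppr_lt0. Qed.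

(** The flow with its label and its time projected onto the rectangle: this is
    defined, continuous and nondecreasing in the label on the whole line.  Time
    comes first, so that [xflow t] is the map from labels to positions. *)
Definition xflow t xi := X (clamp (- L) L xi) (clamp 0 T t).
Definition xflow_xi t xi := Xxi (clamp (- L) L xi) (clamp 0 T t).

Let extend_continuous (F : R -> R -> R) :
  {within `[- L, L] `*` `[0, T], continuous (fun z : R * R => F z.1 z.2)} ->
  continuous (fun z : R * R => F (clamp (- L) L z.1) (clamp 0 T z.2)).
Proof.
move=> Fc.
apply: (continuous_retract (r := fun z => (clamp (- L) L z.1, clamp 0 T z.2)) Fc).
- move=> z.
  have c1 : clamp (- L) L y.1 @[y --> z] --> clamp (- L) L z.1.
    apply: (@cvg_comp _ _ _ (fun y : R * R => y.1) (clamp (- L) L) _ (nbhs z.1)).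
      exact: cvg_fst.
    exact: clamp_continuous.
  have c2 : clamp 0 T y.2 @[y --> z] --> clamp 0 T z.2.
    apply: (@cvg_comp _ _ _ (fun y : R * R => y.2) (clamp 0 T) _ (nbhs z.2)).
      exact: cvg_snd.
    exact: clamp_continuous.
  exact: (cvg_pair c1 c2).
- by move=> z; split; rewrite /= in_itv/= clamp_itv// ltW.
Qed.

Let slice_xi (F : R * R -> R) t : continuous F -> continuous (fun xi => F (xi, t)).
Proof.
move=> Fc xi; apply: (continuous_comp (f := fun xi => (xi, t))); last exact: Fc.
exact: (cvg_pair cvg_id (@cvg_cst _ t _ _ _)).
Qed.

Let slice_t (F : R * R -> R) xi : continuous F -> continuous (fun t => F (xi, t)).
Proof.
move=> Fc t; apply: (continuous_comp (f := fun t => (xi, t))); last exact: Fc.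
exact: (cvg_pair (@cvg_cst _ xi _ _ _) cvg_id).
Qed.

Lemma xflow_continuous t : continuous (xflow t).
Proof. exact: slice_xi (extend_continuous (flow_cont flowX)). Qed.

Lemma xflow_continuous_t xi : continuous (xflow ^~ xi).
Proof. exact: slice_t (extend_continuous (flow_cont flowX)). Qed.

Lemma xflow_xi_continuous t : continuous (xflow_xi t).
Proof. exact: slice_xi (extend_continuous (flow_xi_cont flowX)). Qed.

Let xflow_xi_continuous_t xi : continuous (xflow_xi ^~ xi).
Proof. exact: slice_t (extend_continuous (flow_xi_cont flowX)). Qed.

Lemma xflow_xi_gt0 t xi : 0 <= t < T -> 0 < xflow_xi t xi.
Proof.
move=> /andP[t0 tT]; rewrite /xflow_xi (clamp_id (x := t)) ?t0 ?ltW//.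
by apply: (flow_xi_gt0 flowX); rewrite ?clamp_itv// t0.
Qed.

Lemma xflow_xi_ge0 t xi : 0 <= t <= T -> 0 <= xflow_xi t xi.
Proof.
move=> /andP[t0]; rewrite le_eqVlt => /predU1P[->|tT]; last first.
  by rewrite ltW// xflow_xi_gt0// t0.
have h := cvg_at_left_filter (@xflow_xi_continuous_t xi T).
apply: (@closed_cvg _ _ _ _ (xflow_xi ^~ xi) [set y | 0 <= y] _ _ _ h).
  exact: closed_ge.
near=> s; rewrite /= ltW// xflow_xi_gt0//; apply/andP; split; last first.
  by near: s; exact: nbhs_left_lt.
by near: s; exact: nbhs_left_ge.
Unshelve. all: by end_near. Qed.

Lemma xflowE t xi : 0 <= t <= T -> - L <= xi <= L -> xflow t xi = X xi t.
Proof. by move=> tT xiL; rewrite /xflow !clamp_id. Qed.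

Lemma xflow_xiE t xi : 0 <= t <= T -> - L <= xi <= L -> xflow_xi t xi = Xxi xi t.
Proof. by move=> tT xiL; rewrite /xflow_xi !clamp_id. Qed.

Lemma is_derive_xflow t xi : 0 <= t <= T -> - L < xi < L ->
  is_derive (xi : R) (1 : R) (xflow t) (xflow_xi t xi).
Proof.
move=> tT xiL; have /andP[Lxi xiL'] := xiL.
rewrite xflow_xiE//; last by rewrite !ltW.
apply: (@near_eq_is_derive _ _ _ (X ^~ t)); last exact: (flow_xiE flowX).
have : xi \in `]- L, L[ by rewrite in_itv.
move/near_in_itvoo; apply: filterS => z; rewrite in_itv/= => /andP[z1 z2].
by rewrite xflowE// !ltW.
Qed.

Lemma xflow_homo t : 0 <= t <= T -> {homo xflow t : x y / x <= y}.
Proof.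
move=> tT x y xy.
have cc z : xflow t z = xflow t (clamp (- L) L z).
  by rewrite /xflow (clamp_id (clamp_itv _ _)).
have /andP[x1 x2] := clamp_itv x Lle.
have /andP[y1 y2] := clamp_itv y Lle.
rewrite cc (cc y); apply: (@ger0_derive1_ndecr _ _ (- L) L) => //.
- move=> z; rewrite in_itv/= => zL.
  by have [] := is_derive_xflow tT zL.
- move=> z; rewrite in_itv/= => zL; rewrite derive1E.
  by have [_ ->] := is_derive_xflow tT zL; exact: xflow_xi_ge0.
- by apply: continuous_subspaceT; exact: xflow_continuous.
- exact: clamp_homo.
Qed.

Lemma m0_continuous : continuous m0.
Proof.
have [dm _ _ _] := m0C1c.
by move=> x; apply: differentiable_continuous; exact/derivable1_diffP.
Qed.

Lemma m0_out xi : ~~ (- L < xi < L) -> m0 xi = 0.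
Proof.
have [_ _ _ sm] := m0C1c.
move=> xiL; apply/eqP; apply: contraNT xiL => mx.
have : supp m0 xi by apply: subset_closure.
by move/sm; rewrite /= in_itv.
Qed.

Notation u := (lagrange_u L m0 X).
Notation m := (momentum u).

Lemma lagrange_uE x t : 0 <= t <= T ->
  u x t = potential (- L) L (xflow t) m0 x.
Proof.
move=> tT; rewrite /lagrange_u /potential; apply: eq_Rintegral => th.
by rewrite inE/= in_itv/= => thL; rewrite xflowE.
Qed.

(** The momentum at time [t] depends on the flow only through its values on the
    segment of labels. *)
Lemma momentumE x t : 0 <= t <= T ->
  m x t = potential_momentum (- L) L (xflow t) m0 x.
Proof.
move=> tT; have uE : potential (- L) L (xflow t) m0 = u^~ t.
  by apply/funext => y; rewrite lagrange_uE.
by rewrite /potential_momentum uE.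
Qed.

Lemma O_setE t : 0 <= t <= T ->
  O_set L t X Xxi = xflow t @` regular (- L) L (xflow_xi t).
Proof.
move=> tT; apply/seteqP; split=> y.
  move=> [xi [/andP[xi1 xi2] gxi] <-]; exists xi; last first.
    by rewrite xflowE// !ltW.
  by split; rewrite ?xi1 ?xflow_xiE// !ltW.
move=> [xi [/andP[xi1 xi2] gxi] <-]; exists xi; last first.
  by rewrite xflowE// !ltW.
by split; rewrite ?xi1// -(xflow_xiE tT)// !ltW.
Qed.

Lemma integrable_m0 : mu.-integrable setT (EFin \o m0).
Proof.
have := integrable_continuousM m0_continuous m0_out (@cst_continuous R R (1 : R)).
by apply: eq_integrable => // xi _; rewrite /= mul1r.
Qed.

(** Before the final time all labels in ]- L, L[ are regular, and the
    momentum vanishes outside of the range of the flow; so the regular momentum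
    differs from the momentum at most at the two endpoints of this range. *)
Lemma integral_momentum (phi : R -> R) t : Cc phi -> 0 <= t < T ->
  {within setT `*` `[0, T[, continuous (fun z : R * R => m z.1 z.2)} ->
  \int[mu]_x (phi x * m x t) = \int[mu]_xi (phi (xflow t xi) * m0 xi).
Proof.
move=> cphi /andP[t0 tT] mc; congr fine.
have tTT : 0 <= t <= T by rewrite t0 ltW.
have mphi : measurable_fun setT phi by exact: continuous_measurable_fun cphi.1.
have mm : measurable_fun setT (m ^~ t).
  apply: continuous_measurable_fun => x.
  have mxt : m z.1 z.2 @[z --> within (setT `*` `[0, T[) (nbhs (x, t))] --> m x t.
    move/subspace_continuousP : mc => /(_ (x, t)); apply; split=> //=.
    by rewrite in_itv/= t0.
  apply: cvg_trans mxt => N fN.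
  have : nbhs (x, t) [set z | (setT `*` `[0, T[) z -> N (m z.1 z.2)] by exact: fN.
  have pc : (y, t) @[y --> x] --> (x, t) by exact: (cvg_pair cvg_id (@cvg_cst _ t _ _ _)).
  move=> /pc; apply: (@filterS _ (nbhs x)) => y /=; apply; split=> //=.
  by rewrite in_itv/= t0.
pose m1 := regular_momentum (- L) L (xflow t) (xflow_xi t) m0.
have regE : regular (- L) L (xflow_xi t) = `]- L, L[%classic.
  apply/seteqP; split=> xi /=; rewrite in_itv/=; first by case.
  by move=> xiL; split=> //; rewrite xflow_xi_gt0// t0.
have Yd xi := @is_derive_xflow t xi tTT.
have Yc := @xflow_continuous t.
have Ynd := @xflow_homo t tTT.
have gc := @xflow_xi_continuous t.
have g0 xi := @xflow_xi_ge0 t xi tTT.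
transitivity (\int[mu]_x (phi x * m1 x)%:E)%E; last first.
  rewrite (integral_regular_momentum Llt Yc Ynd Yd gc g0 m0_continuous m0_out mphi).
  rewrite regE [LHS]integral_mkcond; apply: eq_integral => xi _.
  rewrite patchE; case: ifPn => // xiL; rewrite m0_out ?mulr0//.
  by apply: contra xiL; rewrite inE/= in_itv.
apply: ae_eq_integral => //.
- by apply/measurable_EFinP; exact: measurable_funM.
- apply/measurable_EFinP; apply: measurable_funM => //.
  exact: (measurable_regular_momentum Yc Ynd Yd gc m0_continuous m0_out).
exists [set xflow t (- L); xflow t L]; split.
- exact: measurableU.
- by apply: countable_lebesgue_measure0; apply: finite_set_countable.
- move=> x /= xP; apply: contrapT => xE; apply: xP => _; congr EFin.
  congr (_ * _); rewrite /m1 /regular_momentum momentumE//; case: ifPn => //.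
  rewrite notin_setE => xO.
  have [xl|lx] := ltP x (xflow t (- L)); first exact: (momentum_left Yc Ynd m0_continuous m0_out xl).
  have [rx|xr] := ltP (xflow t L) x; first exact: (momentum_right Yc Ynd m0_continuous m0_out rx).
  exfalso; have [||xi] := @IVT _ (xflow t) (- L) L x Lle.
  + exact: continuous_subspaceT.
  + by rewrite min_l ?max_r ?lx ?xr//; exact: Ynd.
  rewrite in_itv/= => /andP[]; rewrite le_eqVlt => /predU1P[<- _ xl|xi1].
    by apply: xE; left; rewrite xl.
  rewrite le_eqVlt => /predU1P[-> xr'|xi2 xiE].
    by apply: xE; right; rewrite xr'.
  by apply: xO; exists xi => //; rewrite regE/= in_itv/= xi1.
Qed.

End Flow.

(** * The image of a signed density as a charge *)

(** The charge is the difference of the images of the positive and negative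
    parts of [f]. *)
Lemma image_charge_exists (R : realType) (Y f : R -> R) :
  measurable_fun setT Y ->
  (@lebesgue_measure R).-integrable setT (EFin \o f) ->
  exists nu : {charge set (measurableTypeR R) -> \bar R},
    (forall A : set (measurableTypeR R), measurable A ->
      (nu A = \int[lebesgue_measure]_(xi in Y @^-1` A) (f xi)%:E)%E) /\
    (forall phi : R -> R, measurable_fun setT phi ->
      (exists M, forall x, `|phi x| <= M) ->
      charge_integral nu phi = \int[lebesgue_measure]_xi (phi (Y xi) * f xi)).
Proof.
move=> mY intf; set mu := @lebesgue_measure R; set mR := measurableTypeR R.
pose fp x := Num.max (f x) 0; pose fn x := Num.max (- f x) 0.
have fp0 x : 0 <= fp x by rewrite /fp le_max lexx orbT.
have fn0 x : 0 <= fn x by rewrite /fn le_max lexx orbT.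
have fpE : EFin \o fp = ((EFin \o f)^\+)%E.
  by apply/funext => x; rewrite funeposE /= -EFin_max.
have fnE : EFin \o fn = ((EFin \o f)^\-)%E.
  by apply/funext => x; rewrite funenegE /= -?EFinN -EFin_max.
have intp : mu.-integrable setT (EFin \o fp) by rewrite fpE integrable_funepos.
have intn : mu.-integrable setT (EFin \o fn) by rewrite fnE integrable_funeneg.
pose p := @image_measure _ _ mR mR R (@density _ mR R mu fp fp0 intp) Y mY.
pose n := @image_measure _ _ mR mR R (@density _ mR R mu fn fn0 intn) Y mY.
pose nu : {charge set mR -> \bar R} :=
  cadd (charge_of_finite_measure p) (cscale (-1) (charge_of_finite_measure n)).
have nuE (A : set mR) : nu A = (p A - n A)%E by rewrite /nu/= /cadd/= cscaleN1.
exists nu; split.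
  move=> A mA; rewrite nuE [RHS]integralE; congr (_ - _)%E.
  - by rewrite [LHS]/(\int[mu]_(xi in Y @^-1` A) (EFin \o fp) xi)%E fpE.
  - by rewrite [LHS]/(\int[mu]_(xi in Y @^-1` A) (EFin \o fn) xi)%E fnE.
move=> phi mphi bphi.
rewrite (charge_integralE (p := p) (n := n))//.
have mphiY : measurable_fun setT (phi \o Y) by exact: measurableT_comp.
have bphiY : exists M, forall x, `|(phi \o Y) x| <= M.
  by have [M Mphi] := bphi; exists M => x; exact: Mphi.
have pE : \int[p]_x phi x = \int[mu]_xi (phi (Y xi) * fp xi).
  congr fine; rewrite (@integral_image_measure _ _ mR mR R _ Y mY (EFin \o phi)).
    by rewrite [LHS](@integral_density _ mR R mu fp fp0 intp (phi \o Y)).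
  exact/measurable_EFinP.
have nE : \int[n]_x phi x = \int[mu]_xi (phi (Y xi) * fn xi).
  congr fine; rewrite (@integral_image_measure _ _ mR mR R _ Y mY (EFin \o phi)).
    by rewrite [LHS](@integral_density _ mR R mu fn fn0 intn (phi \o Y)).
  exact/measurable_EFinP.
rewrite pE nE -RintegralB//; last 2 first.
- exact: (@integrable_boundedM _ mR R mu (phi \o Y) fp).
- exact: (@integrable_boundedM _ mR R mu (phi \o Y) fn).
apply: eq_Rintegral => xi _; rewrite -mulrBr; congr (_ * _).
rewrite /fp /fn; case: (leP (f xi) 0) => [f0|f0].
- by rewrite max_l ?oppr_ge0// sub0r opprK.
- by rewrite max_r ?subr0// oppr_le0 ltW.
Qed.

(** * The final time *)

(** The fiber is compact, so it has a least and a greatest element, and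
    monotonicity fills in what lies between. *)
Lemma nondecreasing_fiber_itv (R : realType) (a b c : R) (Y : R -> R) :
  continuous Y -> {homo Y : x y / x <= y} ->
  [set xi | a <= xi <= b /\ Y xi = c] !=set0 ->
  exists a' b', [/\ a <= a', a' <= b', b' <= b &
    [set xi | a <= xi <= b /\ Y xi = c] = `[a', b']%classic].
Proof.
move=> Yc Ynd fib0; set fib := [set xi | _].
have cfib : compact fib.
  apply: (@subclosed_compact _ _ `[a, b]%classic); last 2 first.
  - exact: segment_compact.
  - by move=> xi [xiab _]; rewrite /= in_itv.
  have -> : fib = `[a, b] `&` Y @^-1` [set c].
    by apply/seteqP; split=> xi /=; rewrite in_itv.
  apply: closedI; first exact: interval_closed.
  by apply: closed_comp => //; exact: closed_eq.
have idc : {within fib, continuous (@id R)} by apply: continuous_subspaceT => ? ?.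
have [a' /[!inE] fa' amin] := compact_EVT_min fib0 cfib idc.
have [b' /[!inE] fb' bmax] := compact_EVT_max fib0 cfib idc.
have [/andP[aa' _] Ya'] := fa'; have [/andP[_ b'b] Yb'] := fb'.
exists a', b'; split=> //; first by apply: bmax; rewrite inE.
apply/seteqP; split=> xi /=; rewrite in_itv/=.
  by move=> fxi; rewrite amin ?inE// bmax ?inE.
move=> /andP[a'xi xib']; split.
  by rewrite (le_trans aa')// (le_trans xib').
by apply/eqP; rewrite eq_le -{1}Yb' -Ya' !Ynd.
Qed.

Section FinalTime.
Context {R : realType}.
Notation mu := (@lebesgue_measure R).
Variables (L T : R) (m0 : R -> R) (X Xxi Xxixi Xt : R -> R -> R).
Hypothesis L0 : 0 < L.
Hypothesis T0 : 0 < T.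
Hypothesis m0C1c : C1c (- L) L m0.
Hypothesis flowX : is_flow L m0 T X Xxi Xxixi Xt.

Notation Y := (xflow L T X).
Notation g := (xflow_xi L T Xxi).
Notation m := (momentum (lagrange_u L m0 X)).

Let Lle : - L <= L. Proof. by rewrite ge0_cp// ltW. Qed.
Let TT : 0 <= T <= T. Proof. by rewrite lexx ltW. Qed.

(** Dominated convergence: [phi] is bounded, and the projected flow is
    continuous in time at [T] from both sides. *)
Lemma cvg_integral_xflow (phi : R -> R) : Cc phi ->
  \int[mu]_xi (phi (Y t xi) * m0 xi) @[t --> T^'-] -->
  \int[mu]_xi (phi (Y T xi) * m0 xi).
Proof.
move=> cphi; have [M phiM] := Cc_bounded cphi.
apply: cvg_at_left_filter.
have intm0 := integrable_m0 m0C1c.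
apply: (@continuity_under_integral R _ (measurableTypeR R) mu
  (fun t xi => phi (Y t xi) * m0 xi) setT measurableT (- 1) (T + 1) _ _
  (fun xi => M * `|m0 xi|)).
- move=> t _; apply: (@integrable_boundedM _ (measurableTypeR R) R mu (phi \o Y t)).
  + apply: continuous_measurable_fun => xi.
    by apply: continuous_comp; [exact: (xflow_continuous L0 T0 flowX)|exact: cphi.1].
  + by exists M => xi; exact: phiM.
  + exact: intm0.
- apply: aeW => xi _ t _; apply: cvgM; last exact: cvg_cst.
  by apply: continuous_comp; [exact: (xflow_continuous_t L0 T0 flowX)|exact: cphi.1].
- apply: (integrableZl measurableT M (integrable_norm intm0)).
- by move=> t _; apply: aeW => xi _; rewrite normrM ler_wpM2r.
- rewrite inE/= in_itv/= ltrDl ltr01 andbT.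
  by rewrite (@lt_trans _ _ 0)// ltrN10.
Qed.

Lemma weak_star_xflow (phi : R -> R) : Cc phi ->
  {within setT `*` `[0, T[, continuous (fun z : R * R => m z.1 z.2)} ->
  \int[mu]_x (phi x * m x t) @[t --> T^'-] -->
  \int[mu]_xi (phi (Y T xi) * m0 xi).
Proof.
move=> cphi mc.
have : {near T^'-, (fun t => \int[mu]_xi (phi (Y t xi) * m0 xi)) =1
                   (fun t => \int[mu]_x (phi x * m x t))}.
  near=> t; apply/esym; apply: (integral_momentum L0 T0 m0C1c flowX cphi _ mc).
  apply/andP; split; near: t; [exact: nbhs_left_ge|exact: nbhs_left_lt].
move/near_eq_cvg/cvg_trans; apply; exact: cvg_integral_xflow.
Unshelve. all: by end_near. Qed.

Variables (N N1 : nat) (x xi1 xi2 : nat -> R).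
Hypothesis NN1 : (N <= N1)%N.
Hypothesis xinj : set_inj `I_N1 x.
Hypothesis FE : F_set L T X Xxi = x @` `I_N1.
Hypothesis FhatE : Fhat_set L T X Xxi = x @` `I_N.
Hypothesis fiberE : forall i, (i < N)%N ->
  flow_fiber L X (x i) T = `[xi1 i, xi2 i]%classic.

Notation V := (regular (- L) L (g T)).

Let Yc : continuous (Y T). Proof. exact: (xflow_continuous L0 T0 flowX). Qed.

Let Ynd : {homo Y T : x y / x <= y}.
Proof. exact: (xflow_homo L0 T0 flowX TT). Qed.

Let Yd xi : - L < xi < L -> is_derive (xi : R) (1 : R) (Y T) (g T xi).
Proof. exact: (is_derive_xflow flowX TT). Qed.

Let gc : continuous (g T).
Proof. exact: (xflow_xi_continuous L0 T0 flowX). Qed.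

Let g_ge0 xi : 0 <= g T xi.
Proof. exact: (xflow_xi_ge0 L0 T0 flowX). Qed.


Let fiber_xflow c :
  flow_fiber L X c T = [set xi | - L <= xi <= L /\ Y T xi = c].
Proof.
apply/seteqP; split=> xi /= [xiL <-]; split=> //.
- by rewrite (xflowE _ TT).
- by rewrite (xflowE _ TT).
Qed.

(* Around a regular label [Y] is injective, whereas a plateau is not reduced to
   a point. *)
Let plateau_not_regular i xi : (i < N)%N -> flow_fiber L X (x i) T xi -> ~ V xi.
Proof.
move=> iN fxi Vxi.
have : Fhat_set L T X Xxi (x i) by rewrite FhatE; exists i.
move=> [_ [a [b [ab fab]]]].
have collapse eta : flow_fiber L X (x i) T eta -> eta = xi.
  move: fxi; rewrite fiber_xflow => -[_ Yxi] [_ Yeta].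
  by apply: (regular_inj Ynd Yd Vxi); rewrite Yxi.
have axi : a = xi by apply: collapse; rewrite fab/= in_itv/= lexx ltW.
have bxi : b = xi by apply: collapse; rewrite fab/= in_itv/= lexx ltW.
by move: ab; rewrite axi bxi ltxx.
Qed.

(* A fiber with two elements would be a nondegenerate interval, and its value
   one of the first [N] points; these differ from [x i] because [x] is
   injective. *)
Let small_fiber_singleton i xi eta : (N <= i < N1)%N ->
  flow_fiber L X (x i) T xi -> flow_fiber L X (x i) T eta -> xi = eta.
Proof.
move=> /andP[Ni iN1]; rewrite fiber_xflow => fxi feta.
have [|a [b [aL ab bL fab]]] := nondecreasing_fiber_itv (a := - L) (b := L)
  (c := x i) (Y := Y T) Yc Ynd.
  by exists xi.
have [ltab|ba] := ltP a b.
  have : Fhat_set L T X Xxi (x i).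
    split; first by rewrite FE; exists i.
    by exists a, b; split=> //; rewrite fiber_xflow.
  rewrite FhatE => -[j jN xji].
  have ji : j = i by apply: xinj; rewrite ?inE//=; exact: leq_trans jN NN1.
  by move: jN; rewrite ji /= ltnNge Ni.
have {ab ba} ab : a = b by apply/eqP; rewrite eq_le ab.
move: fxi feta; rewrite fab ab /= !in_itv/=.
by rewrite -!eq_le => /eqP <- /eqP <-.
Qed.

(* For [N <= i < N1] this is the only label sent to [x i]. *)
Let rep i : R := xget 0 (flow_fiber L X (x i) T).

(* Outside of finitely many labels, each label of the support is either
   regular or in exactly one plateau. *)
Let plateau_split (A : set R) xi : ~ (rep @` `I_N1) xi ->
  \1_A (Y T xi) * m0 xi = \1_A (Y T xi) * m0 xi * \1_V xi +
    \sum_(i < N) \1_A (x i) * (m0 xi * \1_(`[xi1 i, xi2 i]%classic) xi).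
Proof.
move=> nrep; have [xiL|xiL] := boolP (- L < xi < L); last first.
  by rewrite (m0_out m0C1c xiL) mulr0 mul0r big1 ?addr0// => i _; rewrite mul0r mulr0.
have xiL' : - L <= xi <= L by case/andP: xiL => *; rewrite !ltW.
have [gxi|gxi] := ltP 0 (g T xi).
  have Vxi : V xi by split.
  rewrite big1; first by rewrite addr0 [\1_V xi]indicE mem_set// mulr1.
  move=> i _; rewrite [X in _ * (_ * X)]indicE memNset ?mulr0// -(fiberE (ltn_ord i)).
  by move=> /(plateau_not_regular (ltn_ord i)); apply.
have : F_set L T X Xxi (Y T xi).
  exists xi; last by rewrite (xflowE _ TT).
  by split=> //; apply/eqP; rewrite -(xflow_xiE Xxi TT xiL') eq_le gxi g_ge0.
rewrite FE => -[i /= iN1 xiE].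
have fxi : flow_fiber L X (x i) T xi by rewrite fiber_xflow.
have iN : (i < N)%N.
  rewrite ltnNge; apply/negP => Ni; apply: nrep; exists i => //.
  apply: (@small_fiber_singleton i); rewrite ?Ni//.
  by rewrite /rep; apply: xgetPex; exists xi.
rewrite [X in _ * X + _]indicE memNset ?mulr0 ?add0r; last first.
  by case=> _; rewrite ltNge gxi.
rewrite (bigD1 (Ordinal iN))//= -fiberE// [X in _ * (_ * X)]indicE mem_set// mulr1.
rewrite big1 ?addr0 ?xiE// => j ji.
rewrite [X in _ * (_ * X)]indicE memNset ?mulr0// -(fiberE (ltn_ord j)).
rewrite fiber_xflow => -[_ Yxi].
have : (j : nat) = i.
  apply: xinj; rewrite ?inE//=; last by rewrite xiE.
  exact: leq_trans (ltn_ord j) NN1.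
by move=> ij; case/eqP: ji; apply: val_inj.
Qed.

(** Lebesgue decomposition of the image of [m0 dxi], still expressed on the side
    of the labels. *)
Lemma image_m0_decomposition (A : set (measurableTypeR R)) : measurable A ->
  (\int[mu]_(xi in Y T @^-1` A) (m0 xi)%:E =
   \int[mu]_(xi in V) (\1_A (Y T xi) * m0 xi)%:E +
   \sum_(i < N) (\int[mu]_(xi in `[xi1 i, xi2 i]) m0 xi)%:E * \d_(x i) A)%E.
Proof.
move=> mA; have intm0 := integrable_m0 m0C1c.
have mY : measurable_fun setT (Y T).
  exact: continuous_measurable_fun Yc.
have mV : measurable (V : set (measurableTypeR R)).
  by apply: open_measurable; exact: open_regular gc.
have indic_le1 (B : set R) z : `|\1_B z : R| <= 1.
  by rewrite indicE; case: (_ \in _); rewrite ?normr1 ?normr0.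
pose h xi : R := \1_A (Y T xi) * m0 xi.
pose hV xi : R := h xi * \1_V xi.
pose k i xi : R := \1_A (x i) * (m0 xi * \1_(`[xi1 i, xi2 i]%classic) xi).
have intM (w f : R -> R) : measurable_fun setT w ->
    (forall z, `|w z| <= 1) -> mu.-integrable setT (EFin \o f) ->
    mu.-integrable setT (EFin \o (fun z => f z * w z)).
  move=> mw w1 intf; have : exists M, forall z, `|w z| <= M by exists 1.
  move/(@integrable_boundedM _ (measurableTypeR R) R mu w f mw)/(_ intf).
  by apply: eq_integrable => // z _; rewrite /= mulrC.
have inth : mu.-integrable setT (EFin \o h).
  have : mu.-integrable setT (EFin \o (fun z => m0 z * \1_A (Y T z))).
    apply: (intM (fun z => \1_A (Y T z))) => //.
    by apply: (measurableT_comp _ mY); exact: measurable_indic.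
  by apply: eq_integrable => // z _; rewrite /= mulrC.
have inthV : mu.-integrable setT (EFin \o hV).
  by apply: (intM \1_V) => //; exact: measurable_indic.
have intk i : mu.-integrable setT (EFin \o k i).
  have : mu.-integrable setT (EFin \o
      (fun z => m0 z * \1_(`[xi1 i, xi2 i]%classic) z)).
    by apply: intM => //; exact: measurable_indic.
  exact: integrableZl.
transitivity (\int[mu]_xi (h xi)%:E)%E.
  rewrite integral_mkcond; apply: eq_integral => xi _.
  rewrite patchE /h indicE.
  have -> : (xi \in Y T @^-1` A) = (Y T xi \in A) by apply/idP/idP; rewrite !inE.
  by case: ifP => _; rewrite ?mul1r ?mul0r.
transitivity (\int[mu]_xi ((hV xi)%:E + \sum_(i < N) (k i xi)%:E))%E.
  apply: ae_eq_integral => //.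
  - exact: measurable_int inth.
  - apply: emeasurable_funD; first exact: measurable_int inthV.
    by apply: emeasurable_sum => i; exact: measurable_int (intk i).
  exists (rep @` `I_N1); split.
  - apply: countable_measurable; first by move=> z; exact: measurable_set1.
    by apply: finite_set_countable; exact: finite_image (finite_II _).
  - apply: countable_lebesgue_measure0.
    by apply: finite_set_countable; exact: finite_image (finite_II _).
  move=> xi /= nxi; apply: contrapT => nrep; apply: nxi => _.
  by rewrite sumEFin -EFinD; congr EFin; exact: plateau_split.
rewrite integralD//; last first.
  apply: (@integrable_sum _ _ _ mu _ measurableT 'I_N _ _
    (fun i => EFin \o k i)) => i _.
  exact: intk.
congr (_ + _)%E.
  rewrite [RHS]integral_mkcond; apply: eq_integral => xi _.
  by rewrite patchE /hV indicE; case: ifP => _; rewrite ?mulr1 ?mulr0.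
rewrite integral_sum//; last by move=> i; exact: intk.
apply: eq_bigr => i _.
have mI : measurable (`[xi1 i, xi2 i]%classic : set (measurableTypeR R)) by [].
have intmI : mu.-integrable `[xi1 i, xi2 i] (EFin \o m0).
  exact: (integrableS measurableT).
rewrite diracE -indicE /Rintegral fineK ?integrable_fin_num// muleC.
rewrite [in RHS]integral_mkcond -integralZl//; last first.
  by rewrite -integrable_mkcond.
apply: eq_integral => xi _; rewrite patchE /k [X in _ * (_ * X)]indicE.
by case: ifP => _; rewrite ?mulr1 ?mulr0 ?mule0.
Qed.

End FinalTime.

Unset Implicit Arguments.

Theorem theorem1p3 (R : realType) (L : R) (m0 : R -> R) (Tmax : R)
  (X Xxi Xxixi Xt : R -> R -> R)
  (N N1 : nat) (x xi1 xi2 p : nat -> R) :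
  let u := lagrange_u L m0 X in
  let m := momentum u in
  let m1 : R -> R :=
    fun y => if y \in O_set L Tmax X Xxi then m y Tmax else 0 in
  0 < L ->
  C1c (- L) L m0 ->
  maximal_existence_time m0 Tmax u m ->
  is_flow L m0 Tmax X Xxi Xxixi Xt ->
  (N <= N1)%N ->
  set_inj `I_N1 x ->
  F_set L Tmax X Xxi = x @` `I_N1 ->
  Fhat_set L Tmax X Xxi = x @` `I_N ->
  (forall i, (i < N)%N -> flow_fiber L X (x i) Tmax = `[xi1 i, xi2 i]%classic) ->
  (forall i, (i < N)%N ->
    p i = \int[lebesgue_measure]_(xi in `[xi1 i, xi2 i]) m0 xi) ->
  lebesgue_measure.-integrable setT (EFin \o m1) /\
  (exists nu : {charge set (measurableTypeR R) -> \bar R},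
    weak_star_limit m Tmax nu) /\
  (forall nu : {charge set (measurableTypeR R) -> \bar R},
    weak_star_limit m Tmax nu ->
    forall A : set (measurableTypeR R), measurable A ->
      (nu A = \int[lebesgue_measure]_(y in A) (m1 y)%:E
              + \sum_(i < N) (p i)%:E * \d_(x i) A)%E).

Proof.
move=> u m m1 L0 m0C1c maxT flowX NN1 xinj FE FhatE fiberE pE.
have T0 := max_gt0 maxT.
have mc := sol_m_cont (max_sol maxT).
have TT : 0 <= Tmax <= Tmax by rewrite lexx ltW.
have Llt : - L < L by rewrite (@lt_trans _ _ 0)// oppr_lt0.
pose Y := xflow L Tmax X Tmax; pose g := xflow_xi L Tmax Xxi Tmax.
have Yc : continuous Y by exact: (xflow_continuous L0 T0 flowX).
have Ynd : {homo Y : x y / x <= y} by exact: (xflow_homo L0 T0 flowX TT).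
have Yd xi : - L < xi < L -> is_derive (xi : R) (1 : R) Y (g xi).
  exact: (is_derive_xflow flowX TT).
have gc : continuous g by exact: (xflow_xi_continuous L0 T0 flowX).
have g0 xi : 0 <= g xi by exact: (xflow_xi_ge0 L0 T0 flowX).
have fc := m0_continuous m0C1c; have f0 := m0_out m0C1c.
have mY : measurable_fun setT Y by exact: continuous_measurable_fun Yc.
have m1E : m1 = regular_momentum (- L) L Y g m0.
  apply/funext => y; rewrite /m1 /m /u (momentumE L m0 X y TT).
  by rewrite (O_setE L X Xxi TT).
have intm1 : lebesgue_measure.-integrable setT (EFin \o m1).
  rewrite m1E.
  have b1 : exists M : R, forall x : R, `|(fun=> 1 : R) x| <= M.
    by exists 1 => z; rewrite normr1.
  have := integrable_regular_momentum Llt Yc Ynd Yd gc g0 fc f0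
    (measurable_cst (1 : R)) b1.
  (* Abstracting the density keeps conversion from unfolding its derivatives. *)
  move: (regular_momentum _ _ _ _ _) => w h; clear -h.
  by apply: eq_integrable h => // y _; rewrite /= mul1r.
split; first exact: intm1.
have [nu0 [nu0E nu0I]] := image_charge_exists mY (integrable_m0 m0C1c).
have nu0_weak : weak_star_limit m Tmax nu0.
  move=> phi cphi; rewrite (nu0I _ _ (Cc_bounded cphi)); last first.
    exact: continuous_measurable_fun cphi.1.
  exact: (weak_star_xflow L0 T0 m0C1c flowX cphi mc).
split; first by exists nu0.
move=> nu nu_weak A mA.
have -> : nu A = nu0 A.
  apply: charge_integral_unique mA => phi cphi.
  exact: (cvg_unique _ (nu_weak phi cphi) (nu0_weak phi cphi)).
rewrite (nu0E A mA) (image_m0_decomposition L0 T0 m0C1c flowX NN1 xinj FE FhatE fiberE mA).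
congr (_ + _)%E; last by apply: eq_bigr => i _; rewrite pE.
have mA1 : measurable_fun setT (\1_A : R -> R) by exact: measurable_indic.
have bA1 : exists M : R, forall x, `|\1_A x : R| <= M.
  by exists 1 => z; rewrite indicE; case: (_ \in _); rewrite ?normr1 ?normr0.
rewrite -(integral_regular_momentum Llt Yc Ynd Yd gc g0 fc f0 mA1) -m1E.
rewrite [RHS]integral_mkcond; apply: eq_integral => y _.
by rewrite patchE indicE; case: ifP => _; rewrite ?mul1r ?mul0r.
Qed.
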